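(* Let $(R,\mathfrak m)$ be a one-dimensional Cohen-Macaulay local ring with infinite residue field that admits a canonical ideal, and let $I$ be an $\mathfrak m$-primary Ulrich ideal of $R$ with $\mu(I)>2$. Then the following statements are equivalent. (i) $R$ has a canonical reduction. (ii) $R$ is generalized Gorenstein with respect to $I$, and $I$ is a reduction of $\mathfrak m$.
   Context: A canonical ideal of a Cohen-Macaulay local ring $R$ is an ideal isomorphic to a canonical module. An ideal $J\subseteq I$ is a reduction of $I$ if $I^{n+1}=JI^n$ for some $n$. For one-dimensional $R$, a canonical reduction is a canonical ideal that is a reduction of $\mathfrak m$. $\mu$ denotes minimal number of generators. An $\mathfrak m$-primary ideal $I$ is an Ulrich ideal if $I^2=xI$ for some regular element $x\in I$ and $I/I^2$ is a free $R/I$-module. The one-dimensional ring $R$ is generalized Gorenstein with respect to an ideal $\mathfrak a$ if there is an exact sequence of $R$-modules $0\to R\to K\to C\to 0$ with $K$ a canonical ideal of $R$, such that $\mathfrak a=\operatorname{Ann}_R(C)$ and $C$ is free as an $R/\mathfrak a$-module. *)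

(* Defs.v *)
From HB Require Import structures.
From mathcomp Require Import all_boot all_algebra.
From mathcomp Require Import boolp classical_sets functions cardinality.
Set Implicit Arguments.
Unset Strict Implicit.
Unset Printing Implicit Defensive.

Import GRing.Theory.
Local Open Scope ring_scope.
Local Open Scope quotient_scope.

(* R-submodules of V are the predicates of type [submodClosed V]. These are
   boolean, but by [boolp] this is no restriction: [mk_submod] turns any
   Prop-valued predicate with the closure properties into one. *)

Section MkSubmod.
Context (R : comNzRingType) (V : lmodType R).

Lemma mk_submod_closed (P : V -> Prop) (h0 : P 0)
    (hP : forall a u v, P u -> P v -> P (a *: u + v)) :
  submod_closed ((fun v => `[< P v >]) : {pred V}).
Proof.
split; first exact/asboolP.
by move=> a u v /asboolP hu /asboolP hv; apply/asboolP/hP.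
Qed.

Definition mk_submod (P : V -> Prop) (h0 : P 0)
    (hP : forall a u v, P u -> P v -> P (a *: u + v)) : submodClosed V :=
  HB.pack_for (submodClosed V) ((fun v => `[< P v >]) : V -> bool)
    (GRing.isSubSemiModClosed.Build R V _
       (GRing.submod_closed_semi (mk_submod_closed h0 hP))).

Lemma mk_submodP (P : V -> Prop) (h0 : P 0)
    (hP : forall a u v, P u -> P v -> P (a *: u + v)) (v : V) :
  reflect (P v) (v \in mk_submod h0 hP).
Proof. exact: asboolP. Qed.

Definition submod_zmod (S : submodClosed V) : zmodClosed V :=
  HB.pack_for (zmodClosed V) ((fun v => v \in S) : V -> bool)
    (GRing.isZmodClosed.Build V _
       (GRing.submod_closedB (GRing.submodClosedP S))).

End MkSubmod.

(* The ideals of R, the unit ideal included. *)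
Notation ideal R := (submodClosed R^o).

(* A submodule as a module. *)
Section SubmodType.
Context (R : comNzRingType) (V : lmodType R) (S : submodClosed V).

Record submod_type : predArgType :=
  SubmodElt { submod_val : V ; submod_valP : submod_val \in S }.

HB.instance Definition _ := [isSub of submod_type for submod_val].
HB.instance Definition _ := [Choice of submod_type by <:].
HB.instance Definition _ := [SubChoice_isSubLmodule of submod_type by <:].

End SubmodType.

(* The quotient module V / S: the library's quotient group with its scaling. *)
Section QuotMod.
Context (R : comNzRingType) (V : lmodType R) (S : submodClosed V).

Definition quotmod : Type := Quotient.quot (submod_zmod S).
HB.instance Definition _ := GRing.Zmodule.on quotmod.

Definition quot_proj (v : V) : quotmod := \pi_(Quotient.quot (submod_zmod S)) v.

Definition quot_scale (a : R) (q : quotmod) : quotmod :=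
  quot_proj (a *: repr (q : Quotient.quot (submod_zmod S))).

Lemma quot_projE (u v : V) : (quot_proj u = quot_proj v) <-> (u - v \in S).
Proof.
rewrite -[u - v \in S]/(u - v \in submod_zmod S) Quotient.idealrBE.
by split=> /eqP.
Qed.

Lemma quot_projP (q : quotmod) : exists v, q = quot_proj v.
Proof.
by exists (repr (q : Quotient.quot (submod_zmod S))); rewrite /quot_proj reprK.
Qed.

Lemma quot_projD : {morph quot_proj : u v / u + v}.
Proof. by move=> u v; rewrite /quot_proj; exact: raddfD. Qed.

Lemma quot_projZ (a : R) (v : V) :
  quot_proj (a *: v) = quot_scale a (quot_proj v).
Proof.
apply/quot_projE; rewrite -scalerBr; apply: rpredZ.
by apply/quot_projE; rewrite /quot_proj reprK.
Qed.

Lemma quot_scaleA a b (q : quotmod) :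
  quot_scale a (quot_scale b q) = quot_scale (a * b) q.
Proof. by have [v ->] := quot_projP q; rewrite -!quot_projZ scalerA. Qed.

Lemma quot_scale1 : left_id 1 quot_scale.
Proof. by move=> q; have [v ->] := quot_projP q; rewrite -quot_projZ scale1r. Qed.

Lemma quot_scaleDr : right_distributive quot_scale +%R.
Proof.
move=> a p q; have [u ->] := quot_projP p; have [v ->] := quot_projP q.
by rewrite -quot_projD -!quot_projZ -quot_projD scalerDr.
Qed.

Lemma quot_scaleDl (q : quotmod) : {morph quot_scale^~ q : a b / a + b}.
Proof.
move=> a b; have [v ->] := quot_projP q.
by rewrite -!quot_projZ -quot_projD scalerDl.
Qed.

HB.instance Definition _ := GRing.Zmodule_isLmodule.Build R quotmod
  quot_scaleA quot_scale1 quot_scaleDr quot_scaleDl.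

Lemma quot_proj_is_linear : linear quot_proj.
Proof. by move=> a u v; rewrite quot_projD quot_projZ. Qed.

HB.instance Definition _ := GRing.isLinear.Build R V quotmod _ quot_proj
  quot_proj_is_linear.

End QuotMod.

Section Operations.
Context (R : comNzRingType).

Section Module.
Context (V : lmodType R).

Definition full_submod : submodClosed V :=
  @mk_submod R V (fun=> True) I (fun _ _ _ _ _ => I).

(* xS = { x s | s in S } *)
Section Scale.
Context (x : R) (S : submodClosed V).
Let P (v : V) := exists2 w, w \in S & v = x *: w.

Fact scale_submod0 : P 0.
Proof. by exists 0; rewrite ?rpred0 ?scaler0. Qed.

Fact scale_submodP a u v : P u -> P v -> P (a *: u + v).
Proof.
move=> [w wS ->] [w' wS' ->]; exists (a *: w + w'); first by rewrite rpredD ?rpredZ.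
by rewrite scalerDr !scalerA mulrC.
Qed.

Definition scale_submod : submodClosed V := mk_submod scale_submod0 scale_submodP.
End Scale.

(* S \cap T, as a submodule of S *)
Section Restr.
Context (S T : submodClosed V).
Let P (u : submod_type S) : Prop := val u \in T.

Fact restr_submod0 : P 0.
Proof. by rewrite /P raddf0 rpred0. Qed.

Fact restr_submodP a u v : P u -> P v -> P (a *: u + v).
Proof. by rewrite /P linearP => hu hv; rewrite rpredD ?rpredZ. Qed.

Definition restr_submod : submodClosed (submod_type S) :=
  mk_submod restr_submod0 restr_submodP.
End Restr.

End Module.

(* The product ideal IJ: finite sums of products a b, a in I, b in J. *)
Section Product.
Context (I J : ideal R).
Let P (x : R^o) := exists n (a b : 'I_n -> R),
  [/\ forall i, a i \in I, forall i, b i \in J & x = \sum_(i < n) a i * b i].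

Fact ideal_mul0 : P 0.
Proof.
by exists 0, (fun=> 0), (fun=> 0); split; rewrite ?big_ord0 // => -[].
Qed.

Fact ideal_mulP c x y : P x -> P y -> P (c *: x + y).
Proof.
move=> [n [a [b [aI bJ ->]]]] [n' [a' [b' [aI' bJ' ->]]]].
exists (n + n')%N.
exists (fun i => match fintype.split i with inl j => c * a j | inr j => a' j end).
exists (fun i => match fintype.split i with inl j => b j | inr j => b' j end).
split=> [i|i|]; try by case: fintype.split => j //; exact: (rpredZ c (aI j)).
rewrite big_split_ord /= scaler_sumr; congr (_ + _); apply: eq_bigr => i _.
  by rewrite (unsplitK (inl i)) /= -mulrA.
by rewrite (unsplitK (inr i)).
Qed.

Definition ideal_mul : ideal R := mk_submod ideal_mul0 ideal_mulP.
End Product.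

Fixpoint ideal_exp (I : ideal R) (n : nat) : ideal R :=
  if n is n'.+1 then ideal_mul I (ideal_exp I n') else full_submod R^o.

End Operations.

Section Generators.
Context (R : comNzRingType).

Definition spans (M : lmodType R) n (e : 'I_n -> M) :=
  forall v, exists c : 'I_n -> R, v = \sum_(i < n) c i *: e i.

Definition fin_gen (M : lmodType R) := exists n (e : 'I_n -> M), spans e.

(* mu(M) = n *)
Definition min_gens (M : lmodType R) (n : nat) :=
  (exists e : 'I_n -> M, spans e) /\
  (forall k (e : 'I_k -> M), spans e -> (n <= k)%N).

Definition annihilates (a : ideal R) (M : lmodType R) :=
  forall r, r \in a -> forall v : M, r *: v = 0.

(* M is an R/a-module and is free as such, with a finite basis: finiteness of
   the basis is automatic for the finitely generated M used here. *)
Definition free_over (a : ideal R) (M : lmodType R) :=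
  annihilates a M /\
  exists n (e : 'I_n -> M), spans e /\
    forall c : 'I_n -> R, \sum_(i < n) c i *: e i = 0 -> forall i, c i \in a.

End Generators.

Section Rings.
Context (R : comNzRingType).
Implicit Types (I J P m : ideal R).

Definition noetherian := forall I, fin_gen (submod_type I).

Definition maximal_ideal m :=
  1 \notin m /\ forall J, 1 \notin J -> {subset m <= J} -> J =i m.

Definition local_ring m :=
  maximal_ideal m /\ forall J, maximal_ideal J -> J =i m.

Definition prime_ideal P := 1 \notin P /\ prime_idealr_closed (P : {pred R}).

(* P 0 < P 1 < ... < P n; the values of P beyond n are irrelevant. *)
Definition prime_chain n (P : nat -> ideal R) :=
  (forall i, (i <= n)%N -> prime_ideal (P i)) /\
  (forall i, (i < n)%N ->
     {subset P i <= P i.+1} /\ exists2 x, x \in P i.+1 & x \notin P i).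

Definition krull_dim (d : nat) :=
  (exists P : nat -> ideal R, prime_chain d P) /\
  (forall n (P : nat -> ideal R), prime_chain n P -> (n <= d)%N).

(* M-regular sequences; M / sM <> 0 is part of the definition. *)
Fixpoint regular_seq (s : seq R) (M : lmodType R) : Prop :=
  if s is x :: s' then
    injective (fun v : M => x *: v) /\
    regular_seq s' (quotmod (scale_submod x (full_submod M)))
  else exists v : M, v <> 0.

(* depth of a module over the local ring (R, m); the zero module has none *)
Definition depth m (M : lmodType R) (d : nat) :=
  (exists s, [/\ {subset s <= m}, regular_seq s M & size s = d]) /\
  (forall s, {subset s <= m} -> regular_seq s M -> (size s <= d)%N).

Definition cohen_macaulay m := exists2 d, krull_dim d & depth m R^o d.

Definition primary_ideal I :=
  1 \notin I /\
  forall a b : R, a * b \in I -> a \notin I -> exists n, b ^+ n \in I.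

Definition m_primary m I :=
  primary_ideal I /\ forall r : R, r \in m <-> exists n, r ^+ n \in I.

Definition reduction J I :=
  {subset J <= I} /\
  exists n, ideal_exp I n.+1 =i ideal_mul J (ideal_exp I n).

Definition ulrich_ideal m I :=
  [/\ m_primary m I,
      exists x : R, [/\ x \in I, GRing.lreg x & ideal_exp I 2%N =i scale_submod x I]
    & free_over I (quotmod (restr_submod I (ideal_exp I 2%N)))].

End Rings.

Section Canonical.
Context (R : comNzRingType).

Definition injective_module (E : lmodType R) :=
  forall (A B : lmodType R) (i : {linear A -> B}) (f : {linear A -> E}),
    injective i -> exists g : {linear B -> E}, forall a, g (i a) = f a.

Definition injective_resolution (M : lmodType R) (E : nat -> lmodType R)
    (eps : {linear M -> E 0%N}) (delta : forall i, {linear E i -> E i.+1}) :=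
  [/\ forall i, injective_module (E i),
      injective eps,
      forall v, delta 0%N v = 0 <-> exists u, eps u = v
    & forall i v, delta i.+1 v = 0 <-> exists u, delta i u = v].

(* t-coboundaries of the complex Hom(N, E) *)
Definition coboundary (N : lmodType R) (E : nat -> lmodType R)
    (delta : forall i, {linear E i -> E i.+1}) (t : nat) : (N -> E t) -> Prop :=
  match t with
  | 0%N => fun phi => forall x, phi x = 0
  | s.+1 => fun phi => exists psi : {linear N -> E s},
              forall x, phi x = delta s (psi x)
  end.

(* For E an injective resolution of M and k = R/m: dim_k Ext^t(k, M) = r, i.e.
   the t-th cohomology of Hom(k, E) has a k-basis of r elements. *)
Definition ext_dim (m : ideal R) (E : nat -> lmodType R)
    (delta : forall i, {linear E i -> E i.+1}) (t r : nat) :=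
  exists phi : 'I_r -> {linear quotmod m -> E t},
  [/\ forall i x, delta t (phi i x) = 0,
      forall psi : {linear quotmod m -> E t}, (forall x, delta t (psi x) = 0) ->
        exists c : 'I_r -> R,
          coboundary delta (fun x => psi x - \sum_(i < r) c i *: phi i x)
    & forall c : 'I_r -> R,
        coboundary delta (fun x => \sum_(i < r) c i *: phi i x) ->
        forall i, c i \in m].

(* A canonical module of the Cohen-Macaulay local ring (R, m): a maximal
   Cohen-Macaulay module of type 1 and finite injective dimension
   (Bruns-Herzog, Definition 3.3.1). *)
Definition canonical_module (m : ideal R) (W : lmodType R) :=
  fin_gen W /\
  exists d, [/\ krull_dim R d, depth m W d &
    exists (E : nat -> lmodType R) (eps : {linear W -> E 0%N})
           (delta : forall i, {linear E i -> E i.+1}),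
      [/\ injective_resolution eps delta,
          exists n, forall i, (n < i)%N -> forall v : E i, v = 0
        & ext_dim m delta d 1%N]].

Definition canonical_ideal (m K : ideal R) :=
  exists2 W : lmodType R, canonical_module m W &
    exists f : {linear submod_type K -> W}, bijective f.

Definition canonical_reduction (m K : ideal R) :=
  canonical_ideal m K /\ reduction K m.

(* There is an exact sequence 0 -> R -f-> K -g-> C -> 0 with K a canonical
   ideal, a = Ann C and C free over R/a. *)
Definition generalized_gorenstein (m a : ideal R) :=
  exists (K : ideal R) (C : lmodType R)
         (f : {linear R^o -> submod_type K}) (g : {linear submod_type K -> C}),
  [/\ canonical_ideal m K,
      [/\ injective f,
          forall v, g v = 0 <-> exists r, f r = v
        & forall w, exists v, g v = w],
      forall r : R, r \in a <-> (forall w : C, r *: w = 0)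
    & free_over a C].

End Canonical.

(* Main.v *)
Require Import Defs.
From HB Require Import structures.
From mathcomp Require Import all_boot all_algebra.
From mathcomp Require Import boolp classical_sets functions cardinality.
From mathcomp Require Import ring.
Import GRing.Theory.
Local Open Scope ring_scope.

(* Write I^2 = xI, so that A = I / x is a ring between R and its total quotient
   ring, A/R is free over R/I and R : A = I.

   The only property of a canonical ideal K that is needed is reflexivity,
   K : (K : Y) = Y. It holds because Ext^2(R/N, K) = 0 for N containing a power
   of x (K has finite injective dimension, R has depth 1), while Ext^1(k, K) <> 0.

   If mu(I) > 2, then K lies in I: for two members X1, X2 of a basis of I modulo
   I^2 that extends x, and c in K, the dual of K (x, X1) is R : (x, X1) = A, so
   c X2 lies in K (x, X1), and freeness of I / I^2 puts c in I.

   (ii) => (i): if R -> K sends 1 to a and I kills K/aR, then K' = (x/a) K is a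
   canonical ideal with x in K', inside I, and x generates a reduction of m.

   (i) => (ii): K lies in I, so I is a reduction of m. A general element of K is
   a reduction of m, and may be taken for x. Then w = K/x satisfies
   R <= w <= A and w : A = I. Duality shows that R/I has a simple socle
   and that A/w is cyclic with annihilator I; hence w/R, the kernel of
   A/R -> A/w = R/I, is free over R/I. Fractions are avoided by clearing
   powers of x. *)

(** * Elementary operations on ideals *)

Section Ideals.
Context {R : comNzRingType}.
Implicit Types (I J N m : ideal R) (a b r u v w x y z : R).

Lemma ideal0 I : (0 : R) \in I.
Proof. exact: (rpred0 I). Qed.

Lemma idealD I a b : a \in I -> b \in I -> a + b \in I.
Proof. exact: (@rpredD _ I). Qed.

Lemma idealM I a b : b \in I -> a * b \in I.
Proof. exact: (@rpredZ _ _ I a). Qed.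

Lemma idealMr I a b : a \in I -> a * b \in I.
Proof. by rewrite mulrC; exact: idealM. Qed.

Lemma idealN I a : a \in I -> - a \in I.
Proof. by move=> aI; rewrite -mulN1r; exact: idealM. Qed.

Lemma idealB I a b : a \in I -> b \in I -> a - b \in I.
Proof. by move=> aI bI; apply: idealD => //; exact: idealN. Qed.

Lemma ideal_sum (T : Type) (s : seq T) (P : pred T) I (F : T -> R) :
  (forall i, P i -> F i \in I) -> \sum_(i <- s | P i) F i \in I.
Proof.
move=> h; elim/big_ind: _ => //; [exact: ideal0 | exact: idealD].
Qed.

Lemma ideal_addl I a b : a \in I -> a + b \in I -> b \in I.
Proof.
by move=> aI abI; rewrite (_ : b = (a + b) - a); [exact: idealB | ring].
Qed.

Lemma mem_mk_ideal (P : R -> Prop) (h0 : P 0)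
    (hP : forall a u v : R, P u -> P v -> P (a * u + v)) (v : R) :
  v \in @mk_submod R R^o P h0 hP <-> P v.
Proof. exact: (iff_sym (rwP (asboolP _))). Qed.

Fact adjoin0 N z : exists2 y : R, y \in N & exists r, 0 = y + r * z.
Proof. by exists 0; [exact: ideal0 | exists 0; ring]. Qed.

Fact adjoinP N z (a u v : R) :
  (exists2 y : R, y \in N & exists r, u = y + r * z) ->
  (exists2 y : R, y \in N & exists r, v = y + r * z) ->
  exists2 y : R, y \in N & exists r, a * u + v = y + r * z.
Proof.
move=> [y yN [r ->]] [y' yN' [r' ->]]; exists (a * y + y').
  by apply: idealD => //; exact: idealM.
by exists (a * r + r'); ring.
Qed.

Definition adjoin N z : ideal R := @mk_submod R R^o
  (fun v : R => exists2 y : R, y \in N & exists r, v = y + r * z)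
  (adjoin0 N z) (adjoinP N z).

Lemma mem_adjoin N z v :
  v \in adjoin N z <-> exists2 y : R, y \in N & exists r, v = y + r * z.
Proof. exact: mem_mk_ideal. Qed.

Lemma adjoin_sub N z v : v \in N -> v \in adjoin N z.
Proof. by move=> vN; apply/mem_adjoin; exists v => //; exists 0; ring. Qed.

Lemma adjoin_gen N z : z \in adjoin N z.
Proof. by apply/mem_adjoin; exists 0; [exact: ideal0 | exists 1; ring]. Qed.

Fact pair_ideal0 I a b : exists k k' : R, [/\ k \in I, k' \in I & 0 = a * k + b * k'].
Proof. by exists 0, 0; split; rewrite ?ideal0 //; ring. Qed.

Fact pair_idealP I a b (r u v : R) :
  (exists k k' : R, [/\ k \in I, k' \in I & u = a * k + b * k']) ->
  (exists k k' : R, [/\ k \in I, k' \in I & v = a * k + b * k']) ->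
  exists k k' : R, [/\ k \in I, k' \in I & r * u + v = a * k + b * k'].
Proof.
move=> [k [k' [kI kI' ->]]] [l [l' [lI lI' ->]]].
exists (r * k + l), (r * k' + l'); split; last ring.
  by apply: idealD => //; exact: idealM.
by apply: idealD => //; exact: idealM.
Qed.

Definition pair_ideal I a b : ideal R := @mk_submod R R^o
  (fun v : R => exists k k' : R, [/\ k \in I, k' \in I & v = a * k + b * k'])
  (pair_ideal0 I a b) (pair_idealP I a b).

Lemma mem_pair_ideal I a b v : v \in pair_ideal I a b <->
  exists k k' : R, [/\ k \in I, k' \in I & v = a * k + b * k'].
Proof. exact: mem_mk_ideal. Qed.

Lemma mem_scale I x y : y \in scale_submod x I <-> exists2 w : R, w \in I & y = x * w.
Proof. exact: mem_mk_ideal. Qed.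

Fact colon0 N z : 0 * z \in N.
Proof. by rewrite mul0r; exact: ideal0. Qed.

Fact colonP N z (a u v : R) : u * z \in N -> v * z \in N -> (a * u + v) * z \in N.
Proof.
by move=> uN vN; rewrite mulrDl -mulrA; apply: idealD => //; exact: idealM.
Qed.

(** Turns a divisibility claim about all elements of an ideal into an inclusion of ideals, to which
    [ideal_mul_sub] and [nakayama] apply. *)
Definition colon N z : ideal R := @mk_submod R R^o
  (fun v : R => v * z \in N) (colon0 N z) (colonP N z).

Lemma mem_colon N z v : v \in colon N z <-> v * z \in N.
Proof. exact: mem_mk_ideal. Qed.

Definition principal x : ideal R := scale_submod x (full_submod R^o).

Lemma mem_principal x y : y \in principal x <-> exists r, y = x * r.
Proof.
split=> [/mem_scale [w _ ->]|[r ->]]; first by exists w.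
by apply/mem_scale; exists r => //; apply/mem_mk_ideal.
Qed.

Lemma mem_ideal_mulP I J x : x \in ideal_mul I J <-> exists n (a b : 'I_n -> R),
  [/\ forall i, a i \in I, forall i, b i \in J & x = \sum_(i < n) a i * b i].
Proof. exact: mem_mk_ideal. Qed.

Lemma mem_ideal_mul I J a b : a \in I -> b \in J -> a * b \in ideal_mul I J.
Proof.
move=> aI bJ; apply/mem_ideal_mulP; exists 1%N, (fun=> a), (fun=> b).
by split=> //; rewrite big_ord1.
Qed.

Lemma ideal_mul_sub I J N :
  (forall a b, a \in I -> b \in J -> a * b \in N) ->
  {subset ideal_mul I J <= N}.
Proof.
move=> h v /mem_ideal_mulP [n [a [b [aI bJ ->]]]].
by apply: ideal_sum => i _; exact: h.
Qed.

Lemma ideal_exp0 m x : x \in ideal_exp m 0.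
Proof. exact/mem_mk_ideal. Qed.

Lemma exprn_ideal_exp m a k : a \in m -> a ^+ k \in ideal_exp m k.
Proof.
move=> am; elim: k => [|k IHk]; first exact: ideal_exp0.
by rewrite exprS; exact: mem_ideal_mul.
Qed.

Lemma ideal_valZ I a (u : submod_type I) : (val (a *: u) : R) = a * (val u : R).
Proof. by []. Qed.

Lemma ideal_val_sum I n (F : 'I_n -> submod_type I) :
  (val (\sum_(i < n) F i) : R) = \sum_(i < n) (val (F i) : R).
Proof. exact: (raddf_sum (val : submod_type I -> R^o)). Qed.

End Ideals.

(** * Ascending chains in a Noetherian ring *)

Section Noetherian.
Context {R : comNzRingType} (hN : noetherian R).
Implicit Types (I J N : ideal R) (a b r u w x y z : R).

Lemma noetherian_gens I : exists n (g : 'I_n -> R), (forall i, g i \in I) /\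
  forall v : R, v \in I -> exists c : 'I_n -> R, v = \sum_(i < n) c i * g i.
Proof.
have [n [e he]] := hN I; exists n, (fun i => val (e i)); split=> [i|v vI].
  exact: valP.
have [c hc] := he (SubmodElt vI); exists c.
have := congr1 (fun u : submod_type I => val u : R) hc; rewrite /= => ->.
by rewrite ideal_val_sum; apply: eq_bigr => i _; rewrite ideal_valZ.
Qed.

Definition in_span (v : nat -> R) q r :=
  exists s : nat -> R, r = \sum_(i < q) s i * v i.

Lemma in_span_comb v q a r r' :
  in_span v q r -> in_span v q r' -> in_span v q (a * r + r').
Proof.
move=> [s ->] [s' ->]; exists (fun i => a * s i + s' i).
rewrite mulr_sumr -big_split; apply: eq_bigr => i _ /=; ring.
Qed.

Lemma in_span_leq v q q' r : (q <= q')%N -> in_span v q r -> in_span v q' r.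
Proof.
move=> le_qq' [s ->]; exists (fun i => if (i < q)%N then s i else 0).
rewrite (big_ord_widen _ (fun i => s i * v i) le_qq') big_mkcond.
by apply: eq_bigr => i _; case: ifP => _; rewrite ?mul0r.
Qed.

Lemma in_span_gen v q : in_span v q.+1 (v q).
Proof.
exists (fun i => if i == q then 1 else 0); rewrite big_ord_recr /= eqxx mul1r.
rewrite big1 ?add0r // => i _; rewrite ltn_eqF ?mul0r //.
Qed.

(** The spans of the initial segments of [v] have an ideal as union; its finitely many generators
    already lie in the span of one segment, whose length serves as [q]. *)
Lemma noetherian_seq (v : nat -> R) : exists q, in_span v q (v q).
Proof.
have h0 : exists q, in_span v q 0.
  by exists 0%N, (fun=> 0); rewrite big_ord0.
have hP a u w : (exists q, in_span v q u) -> (exists q, in_span v q w) ->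
    exists q, in_span v q (a * u + w).
  move=> [q hq] [q' hq']; exists (maxn q q'); apply: in_span_comb.
    by apply: in_span_leq hq; rewrite leq_maxl.
  by apply: in_span_leq hq'; rewrite leq_maxr.
pose J : ideal R := @mk_submod R R^o _ h0 hP.
have hJ u : u \in J <-> exists q, in_span v q u by exact: mem_mk_ideal.
have [n [g [gJ gen]]] := noetherian_gens J.
have /choice [q hq] : forall i, exists q, in_span v q (g i).
  by move=> i; exact/hJ/gJ.
pose Q := (\max_(i < n) q i)%N; exists Q.
have /gen [c ->] : v Q \in J by apply/hJ; exists Q.+1; exact: in_span_gen.
elim/big_ind: _ => [|r r' hr hr'|i _].
- by exists (fun=> 0); rewrite big1 // => i _; rewrite mul0r.
- by rewrite -[r]mul1r; exact: in_span_comb.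
- rewrite -[_ * _]addr0; apply: in_span_comb; last first.
    by exists (fun=> 0); rewrite big1 // => j _; rewrite mul0r.
  by apply: in_span_leq (hq i); exact: leq_bigmax.
Qed.

(** Failure would give, by choice, a strictly increasing chain [X] of counterexamples; elements of
    [X k.+1] outside [X k] contradict [noetherian_seq]. *)
Lemma noetherian_ind (P : ideal R -> Prop) :
  (forall N, (forall N', {subset N <= N'} -> (exists2 z, z \in N' & z \notin N) ->
     P N') -> P N) -> forall N, P N.
Proof.
move=> step N; apply: contrapT => nPN.
have /choice [f hf] : forall X : {N | ~ P N}, exists Y : {N | ~ P N},
    {subset sval X <= sval Y} /\ exists2 z, z \in sval Y & z \notin sval X.
  move=> [X nPX] /=; apply: contrapT => hX; apply: nPX; apply: step => N' s1 s2.
  by apply: contrapT => nPN'; apply: hX; exists (exist _ N' nPN').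
pose X k := iter k f (exist _ N nPN).
have /choice [v hv] : forall k, exists v, v \in sval (X k.+1) /\ v \notin sval (X k).
  by move=> k; have [_ [z z1 z2]] := hf (X k); exists z.
have mono k l : (k <= l)%N -> {subset sval (X k) <= sval (X l)}.
  elim: l => [|l IHl]; first by rewrite leqn0 => /eqP->.
  rewrite leq_eqVlt => /orP[/eqP-> //|]; rewrite ltnS => /IHl h u /h.
  exact: (hf (X l)).1.
have [q [s hs]] := noetherian_seq v; have /negP := (hv q).2; apply.
rewrite hs; apply: ideal_sum => i _; apply: idealM.
by apply: (mono i.+1 q (ltn_ord i)); exact: (hv i).1.
Qed.

End Noetherian.

(** * Units and Nakayama's lemma in a local ring *)

Section Local.
Context {R : comNzRingType} {m : ideal R}.
Context (hN : noetherian R) (hloc : local_ring m).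
Implicit Types (I J N : ideal R) (a b r u w x y z : R).

Lemma exists_maximal N : 1 \notin N -> exists2 M, maximal_ideal M & {subset N <= M}.
Proof.
elim/(noetherian_ind hN): N => N IH N1.
have [maxN|] := pselect (maximal_ideal N); first by exists N.
move=> nmax; have [J [J1 NJ JN]] : exists J, [/\ 1 \notin J, {subset N <= J}
    & exists2 z, z \in J & z \notin N].
  apply: contrapT => h; apply: nmax; split=> // J J1 NJ z; apply/idP/idP; last exact: NJ.
  by move=> zJ; apply: contrapT => /negP zN; apply: h; exists J; split=> //; exists z.
by have [M maxM JM] := IH J NJ JN J1; exists M => // z /NJ/JM.
Qed.

Lemma one_notin_max : 1 \notin m.
Proof. by case: hloc => -[]. Qed.

Lemma local_unit r : r \notin m -> exists u, u * r = 1.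
Proof.
move=> rm; have [/mem_principal [u ->]|/negP h] := pselect ((1 : R) \in principal r).
  by exists u; rewrite mulrC.
have [M /(hloc.2) Mm sM] := exists_maximal _ h.
by move: rm; rewrite -Mm sM //; apply/mem_principal; exists 1; rewrite mulr1.
Qed.

Lemma local_mem_cancel I u r : u \notin m -> u * r \in I -> r \in I.
Proof.
move=> /local_unit [w wu] urI; rewrite -[r]mul1r -wu -mulrA; exact: idealM.
Qed.

Lemma max_notinM a b : a \notin m -> b \notin m -> a * b \notin m.
Proof. by move=> am; apply: contra => /(local_mem_cancel _ _ _ am). Qed.

(** Generators of [I] are eliminated one at a time: [S q v] puts [v] in [J] plus the span of the
    first [q] of them, and [q] descends from [n] to 0. *)
Lemma nakayama I J : (forall v : R, v \in I ->
    exists y w, [/\ y \in J, w \in ideal_mul m I & v = y + w]) ->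
  {subset I <= J}.
Proof.
move=> hIJ; have [n [g [gI gen]]] := noetherian_gens hN I.
pose S q v := exists y c, y \in J /\ v = y + \sum_(i < n | (i < q)%N) c i * g i.
have mI w : w \in ideal_mul m I -> exists2 c : 'I_n -> R,
    forall i, c i \in m & w = \sum_(i < n) c i * g i.
  move=> /mem_ideal_mulP [p [a [b [am bI ->]]]].
  have /choice [c hc] : forall k, exists c : 'I_n -> R, b k = \sum_i c i * g i.
    by move=> k; exact: gen.
  exists (fun i => \sum_k a k * c k i).
    by move=> i; apply: ideal_sum => k _; exact: idealMr.
  transitivity (\sum_k \sum_i a k * c k i * g i).
    by apply: eq_bigr => k _; rewrite hc mulr_sumr; apply: eq_bigr => i _; rewrite mulrA.
  by rewrite exchange_big; apply: eq_bigr => i _; rewrite mulr_suml.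
have key q : (forall v : R, v \in I -> S q v) -> forall v : R, v \in I -> v \in J.
  elim: q => [|q IHq] hS v vI.
    have [y [c [yJ ->]]] := hS v vI.
    by rewrite big_pred0 ?addr0.
  apply: IHq v vI => v vI.
  have [ltqn|leqn] := ltnP q n; last first.
    have [y [c [yJ ->]]] := hS v vI; exists y, c; split=> //; congr (_ + _).
    apply: eq_bigl => i.
    by rewrite (leq_trans (ltn_ord i) leqn) (leq_trans (ltn_ord i) (leqW leqn)).
  pose i0 := Ordinal ltqn.
  have split c : \sum_(i < n | (i < q.+1)%N) c i * g i =
      c i0 * g i0 + \sum_(i < n | (i < q)%N) c i * g i.
    rewrite (bigD1 i0) //=; congr (_ + _); apply: eq_bigl => i.
    by rewrite ltnS -val_eqE /= [(i < q)%N]ltn_neqAle andbC.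
  (* Substituting the expressions of all generators into [eg] leaves [g i0] with a coefficient in
     [m] on the right; one minus it is a unit. *)
  have hg : S q (g i0).
    have [y [w [yJ /mI [c cm ->] eg]]] := hIJ _ (gI i0).
    have /choice [y' /choice [d hd]] : forall i, exists y c, y \in J /\
        g i = y + \sum_(i < n | (i < q.+1)%N) c i * g i by move=> i; exact: hS.
    have eg' : g i0 = (y + \sum_i c i * y' i) +
        \sum_(j < n | (j < q.+1)%N) (\sum_i c i * d i j) * g j.
      rewrite {1}eg -addrA; congr (_ + _).
      under [X in _ = _ + X]eq_bigr => j _ do rewrite mulr_suml.
      rewrite exchange_big -big_split; apply: eq_bigr => i _ /=.
      rewrite {1}(hd i).2 mulrDr mulr_sumr; congr (_ + _); apply: eq_bigr => j _.
      by rewrite mulrA.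
    set Y := y + _ in eg'; set e := fun j => \sum_i c i * d i j in eg'.
    have YJ : Y \in J.
      by apply: idealD => //; apply: ideal_sum => i _; apply: idealM; exact: (hd i).1.
    have em : e i0 \in m by apply: ideal_sum => i _; exact: idealMr.
    have /local_unit [u hu] : 1 - e i0 \notin m.
      apply: contra one_notin_max => h; rewrite -(subrK (e i0) 1); exact: idealD.
    exists (u * Y), (fun j => u * e j); split; first exact: idealM.
    have eg2 : (1 - e i0) * g i0 = Y + \sum_(j < n | (j < q)%N) e j * g j.
      rewrite mulrBl mul1r {1}eg' (split e) /e; ring.
    rewrite -[g i0]mul1r -{1}hu -mulrA eg2 mulrDr mulr_sumr; congr (_ + _).
    by apply: eq_bigr => j _; rewrite mulrA.
  have [y [c [yJ ->]]] := hS v vI; rewrite split.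
  have [y' [c' [yJ' ->]]] := hg.
  exists (y + c i0 * y'), (fun j => c i0 * c' j + c j); split.
    by apply: idealD => //; exact: idealM.
  rewrite [RHS](_ : _ = y + c i0 * y' + (c i0 * (\sum_(i < n | (i < q)%N) c' i * g i)
      + \sum_(i < n | (i < q)%N) c i * g i)); first ring.
  congr (_ + _); rewrite mulr_sumr -big_split; apply: eq_bigr => j _ /=; ring.
move=> v vI; apply: (key n) v vI => v /gen [c ->].
exists 0, c; split; first exact: ideal0.
by rewrite add0r; apply: eq_bigl => i; rewrite ltn_ord.
Qed.

End Local.

(** * Injective modules *)

Section LinearMaps.
Context {R : comNzRingType}.

Lemma linear_intro (U V : lmodType R) (f : U -> V) :
  linear f -> exists g : {linear U -> V}, g =1 f.
Proof.
move=> hf.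
by exists (HB.pack_for {linear U -> V} f (GRing.isLinear.Build R U V *:%R f hf)).
Qed.

Lemma quot_lift (V M : lmodType R) (S : submodClosed V) (g : {linear V -> M}) :
  (forall v, v \in S -> g v = 0) ->
  exists psi : {linear quotmod S -> M}, forall v, psi (quot_proj S v) = g v.
Proof.
move=> gS; have gE u v : quot_proj S u = quot_proj S v -> g u = g v.
  by move=> /quot_projE /gS; rewrite linearB => /eqP; rewrite subr_eq0 => /eqP.
have /choice [s hs] : forall q : quotmod S, exists v, q = quot_proj S v.
  exact: quot_projP.
have [|psi hpsi] := @linear_intro (quotmod S) M (g \o s).
  move=> a p q /=; rewrite -linearP; apply: gE.
  by rewrite -[LHS]hs [RHS]linearP; congr (_ *: _ + _); exact: hs.
by exists psi => v; rewrite hpsi /=; apply: gE; exact/esym/hs.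
Qed.

Lemma regular_lift (M : lmodType R) (I : ideal R) (e : M) :
  (forall r : R, r \in I -> r *: e = 0) ->
  exists psi : {linear quotmod I -> M}, forall r : R, psi (quot_proj I r) = r *: e.
Proof.
move=> he; have [|g hg] := @linear_intro R^o M (fun r : R => r *: e).
  by move=> a u v /=; rewrite scalerDl scalerA.
have [|psi hpsi] := @quot_lift R^o M I g.
  by move=> v vI; rewrite hg; exact: he.
by exists psi => r; rewrite hpsi hg.
Qed.

(* An element killed by N is a homomorphism from R/N; it is prescribed here on the
   cyclic submodule generated by z. *)
Lemma injective_extend (E : lmodType R) (N : ideal R) (z : R) (g : E) :
  injective_module E -> (forall r : R, r * z \in N -> r *: g = 0) ->
  exists f : E, (forall r : R, r \in N -> r *: f = 0) /\ z *: f = g.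
Proof.
move=> injE hg.
have [|i hi] := @regular_lift (quotmod N) (colon N z) (quot_proj N z).
  move=> r /mem_colon rz; rewrite -linearZ -[RHS](linear0 (@quot_proj _ _ N)).
  by apply/quot_projE; rewrite subr0.
have [|f0 hf0] := @regular_lift E (colon N z) g.
  by move=> r /mem_colon; exact: hg.
have inji : injective i.
  move=> p q; have [u ->] := quot_projP p; have [v ->] := quot_projP q.
  rewrite !hi -!linearZ => /quot_projE uvN; apply/quot_projE/mem_colon.
  by rewrite mulrBl.
have [h hh] := injE _ _ i f0 inji; exists (h (quot_proj N (1 : R))); split.
  move=> r rN; rewrite -linearZ -linearZ -[RHS](linear0 h); congr (h _).
  rewrite -[RHS](linear0 (@quot_proj _ _ N)); apply/quot_projE.
  by rewrite subr0; exact: idealMr.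
rewrite -linearZ -linearZ -[RHS]scale1r -hf0 -hh hi scale1r.
by congr (h (quot_proj N _)); exact: mulr1.
Qed.

(** For N = 0 the condition in [injective_extend] is vacuous, because [x] is regular. *)
Lemma injective_divisible (E : lmodType R) (x : R) (g : E) :
  injective_module E -> GRing.lreg x -> exists f : E, x *: f = g.
Proof.
move=> injE regx; pose Z : ideal R := principal 0.
have [|f [_ hf]] := @injective_extend E Z x g injE; last by exists f.
move=> r /mem_principal [k]; rewrite mul0r => rx0.
suff -> : r = 0 by rewrite scale0r.
by apply: regx; rewrite mulr0 mulrC.
Qed.

End LinearMaps.

(** Equivalently, [m] lies in the radical of every ideal that contains a power of [x]. *)
Definition nil_mod {R : comNzRingType} (m : ideal R) (x : R) :=
  forall r : R, r \in m -> forall j, exists L k, r ^+ L = x ^+ j * k.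

(** * Reflexivity of canonical ideals *)

Section Duality.
Context {R : comNzRingType} {m : ideal R}.
Context (hN : noetherian R) (hloc : local_ring m).
Context (x : R) (xm : x \in m) (regx : GRing.lreg x) (nilx : nil_mod m x).
Implicit Types (I J N : ideal R).

(** The generators of [m] are treated in turn: the current multiple of [z] is multiplied by the last
    power of [g i] that keeps it outside [N]. *)
Lemma socle_elt N (z : R) j : x ^+ j \in N -> z \notin N ->
  exists t : R, t * z \notin N /\ forall r : R, r \in m -> r * (t * z) \in N.
Proof.
move=> xN zN; have [n [g [gm gen]]] := noetherian_gens hN m.
suff [t [tz ht]] : exists t : R, t * z \notin N /\
    forall i, i \in enum 'I_n -> g i * (t * z) \in N.
  exists t; split=> // r /gen [c ->]; rewrite mulr_suml; apply: ideal_sum => i _.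
  by rewrite -mulrA; apply: idealM; apply: ht; rewrite mem_enum.
elim: (enum 'I_n) => [|i s [t [tz ht]]]; first by exists 1; rewrite mul1r.
have ex : exists L, g i ^+ L * (t * z) \in N.
  have [L [k gL]] := nilx _ (gm i) j; exists L.
  by rewrite gL -mulrA; exact: idealMr.
case: (ex_minnP ex) => -[|L] hL minL; first by rewrite expr0 mul1r (negPf tz) in hL.
exists (g i ^+ L * t); split.
  by apply/negP => h; have := minL L; rewrite mulrA h ltnn => /(_ isT).
move=> k; rewrite inE => /orP[/eqP->|ks]; first by rewrite !mulrA -exprS -mulrA.
rewrite (_ : _ * _ = g i ^+ L * (g k * (t * z))); last ring.
exact/idealM/ht.
Qed.

Lemma mulr_mem_max N (z r : R) :
  z \notin N -> r * z \in N -> r \in m.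
Proof. by move=> zN rz; apply: contraR zN => rm; exact: local_mem_cancel hN hloc _ _ _ rm rz. Qed.

Section Resolution.
Context (W : lmodType R) (E : nat -> lmodType R) (eps : {linear W -> E 0%N})
  (delta : forall i, {linear E i -> E i.+1}).
Context (hres : injective_resolution eps delta).

(* Hom(R/N, E_i) -> Hom(R/N, Z_(i+1)) is onto, i.e. Ext^(i+1)(R/N, W) = 0;
   an element of Hom(R/N, E) is an element of E killed by N. *)
Definition ext_vanishes N i := forall e : E i.+1, delta i.+1 e = 0 ->
  (forall r : R, r \in N -> r *: e = 0) ->
  exists2 f : E i, (forall r : R, r \in N -> r *: f = 0) & delta i f = e.

(* The residue field embeds in R/xR, and Ext^(i+2)(R/xR, W) = 0. *)
Lemma ext_vanishes_dim_shift i :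
  (forall N j, x ^+ j \in N -> ext_vanishes N i.+2) -> ext_vanishes m i.+1.
Proof.
case: hres => injE _ _ exE IH e de me.
have [||t [tz mt]] := @socle_elt (principal x) 1 1.
- by rewrite expr1; apply/mem_principal; exists 1; rewrite mulr1.
- apply: contra (one_notin_max hloc) => /mem_principal [r ->]; exact: idealMr.
rewrite mulr1 in tz mt.
have [|g [xg zg]] := @injective_extend R (E i.+2) (principal x) t e (injE _).
  by move=> r /(mulr_mem_max _ _ _ tz) /me.
(* The connecting map: [delta g] is a cocycle on R/(x, t), hence the coboundary of some [f'], and
   [g - f'] becomes a cocycle on R/xR. *)
have [|||f' f'0 df'] := IH (adjoin (principal x) t) 1 _ (delta i.+2 g).
- by rewrite expr1; apply/adjoin_sub/mem_principal; exists 1; rewrite mulr1.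
- by apply/exE; exists g.
- move=> r /mem_adjoin [y yx [s ->]]; rewrite -linearZ /=.
  by rewrite scalerDl -scalerA xg // zg add0r linearZ /= de scaler0.
have xx : x \in principal x by apply/mem_principal; exists 1; rewrite mulr1.
have xf' : x *: f' = 0 by apply: f'0; exact: adjoin_sub.
have tf' : t *: f' = 0 by apply: f'0; exact: adjoin_gen.
have [e' de'] : exists e', delta i.+1 e' = g - f'.
  by apply/exE; rewrite linearB /= df' subrr.
(* Divisibility by [x] corrects [e'] to [e' - delta u'], which [x] kills; multiplying by [t]
   restricts it to the residue field. *)
have [u du] : exists u, delta i u = x *: e'.
  by apply/exE; rewrite linearZ /= de' scalerBr xf' xg // subrr.
have [u' xu'] := injective_divisible _ x u (injE i) regx.
exists (t *: (e' - delta i u')).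
  move=> r /mt /mem_principal [k rt]; rewrite scalerA rt mulrC -scalerA.
  by rewrite scalerBr -linearZ /= xu' du subrr scaler0.
rewrite linearZ linearB /= de' (_ : delta i.+1 (delta i u') = 0).
  by rewrite subr0 scalerBr zg tf' subr0.
by apply/exE; exists u'.
Qed.

(** Noetherian induction along 0 -> R/m -> R/N -> R/(N + Rt) -> 0, with [t] a socle element modulo
    N: [f1] corrects [e] on the socle, [f2] handles the rest. *)
Lemma ext_vanishes_devissage i : ext_vanishes m i ->
  forall N j, x ^+ j \in N -> ext_vanishes N i.
Proof.
case: hres => injE _ _ exE hm; elim/(noetherian_ind hN) => N IH j xN e de Ne.
have [N1|/negP N1] := pselect ((1 : R) \in N).
  exists 0; first by move=> r _; rewrite scaler0.
  by rewrite linear0 -(Ne 1 N1) scale1r.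
have [t [tN mt]] := socle_elt _ _ _ xN N1; rewrite mulr1 in tN mt.
have [||g mg dg] := hm (t *: e).
- by rewrite linearZ /= de scaler0.
- by move=> r /mt rt; rewrite scalerA Ne.
have [|f1 [Nf1 tf1]] := @injective_extend R (E i) N t g (injE _).
  by move=> r /(mulr_mem_max _ _ _ tN) /mg.
have [|||||f2 Nf2 df2] := IH (adjoin N t) _ _ j _ (e - delta i f1).
- by move=> z; exact: adjoin_sub.
- by exists t => //; exact: adjoin_gen.
- exact: adjoin_sub.
- rewrite linearB de sub0r (_ : delta i.+1 (delta i f1) = 0) ?oppr0 //.
  by apply/exE; exists f1.
- move=> r /mem_adjoin [y yN [s ->]]; rewrite scalerBr -linearZ /=.
  rewrite !scalerDl -!scalerA tf1 Ne // Nf1 // !add0r [delta i _]linearZ /= dg.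
  by rewrite subrr.
exists (f1 + f2); last by rewrite linearD df2 addrC subrK.
move=> r rN; rewrite scalerDr Nf1 // Nf2 ?addr0 //; exact: adjoin_sub.
Qed.

(** Descending induction from the end of the resolution. As [ext_vanishes N i.+1] concerns
    Ext^(i+2), all degrees from 2 on are covered. *)
Lemma ext_vanishing n : (forall i, (n < i)%N -> forall v : E i, v = 0) ->
  forall i N j, x ^+ j \in N -> ext_vanishes N i.+1.
Proof.
move=> hn; suff H k : forall i, (n <= k + i)%N -> forall N j, x ^+ j \in N ->
    ext_vanishes N i.+1.
  by move=> i; apply: (H n); rewrite leq_addr.
elim: k => [|k IHk] i hi N j xN.
  move=> e _ _; exists 0; first by move=> r _; rewrite scaler0.
  by rewrite [RHS]hn ?linear0 // ltnS ltnW.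
apply: ext_vanishes_devissage xN; apply: ext_vanishes_dim_shift => N' j' xN'.
by apply: IHk xN'; rewrite addnS -addSn.
Qed.

End Resolution.

(* K : (K : Y) = Y: as d = x ^+ j lies in Y, the elements of K : Y are k / d with
   k in K. If z is not in Y, we may assume that m z is in Y; pulling a nonzero
   class of Ext^1(R/m, W) back along (Y + Rz)/Y = R/m gives a homomorphism
   Y -> K that does not extend to Y + Rz, i.e. some k / d. *)
Lemma canonical_reflexive (K Y : ideal R) j (z : R) :
  krull_dim R 1%N -> canonical_ideal m K -> x ^+ j \in Y ->
  (forall k : R, k \in K ->
    (forall y : R, y \in Y -> exists2 k' : R, k' \in K & k * y = x ^+ j * k') ->
    exists2 k' : R, k' \in K & k * z = x ^+ j * k') ->
  z \in Y.
Proof.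
move=> [ex1 dim1] [W [_ [d [[exd dimd] _ [E [eps [delta [hres [n hn] hext]]]]]]]].
have {dimd exd dim1 ex1} d1 : d = 1%N.
  case: exd ex1 => P /dim1 le1 [P' /dimd le2].
  by apply/eqP; rewrite eqn_leq le1 le2.
subst d; move=> [f bijf] xY hz.
have van := ext_vanishing _ _ _ _ hres n hn.
(* A cocycle whose class in Ext^1(R/m, W) is nonzero. *)
have [e [de me ne]] : exists e : E 1%N, [/\ delta 1%N e = 0,
    forall r : R, r \in m -> r *: e = 0
  & ~ exists2 e0 : E 0%N, (forall r : R, r \in m -> r *: e0 = 0) & delta 0%N e0 = e].
  have [phi [dphi _ hphi]] := hext.
  exists (phi ord0 (quot_proj m (1 : R))); split; first exact: dphi.
    move=> r rm; rewrite -linearZ -linearZ -[RHS](linear0 (phi ord0)); congr (phi _ _).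
    rewrite -[RHS](linear0 (@quot_proj _ _ m)); apply/quot_projE.
    by rewrite subr0; exact: idealMr.
  move=> [e0 me0 de0]; have [psi hpsi] := regular_lift _ _ _ me0.
  have /negP := one_notin_max hloc; apply; apply: (hphi (fun=> 1) _ ord0).
  exists psi => q; have [r ->] := quot_projP q; rewrite big_ord1 scale1r hpsi linearZ /= de0.
  by rewrite -linearZ -linearZ; congr (phi _ (quot_proj m _)); rewrite /GRing.scale /= mulr1.
apply: contrapT => /negP zY0.
have [t [tY mtY]] := socle_elt _ _ _ xY zY0.
set z' := t * z in tY mtY.
have hz' k : k \in K ->
    (forall y : R, y \in Y -> exists2 k' : R, k' \in K & k * y = x ^+ j * k') ->
    exists2 k' : R, k' \in K & k * z' = x ^+ j * k'.
  move=> kK /(hz _ kK) [k' kK' hk']; exists (t * k'); first exact: idealM.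
  by rewrite /z' mulrCA hk' mulrCA.
case: (hres) => injE injeps exeps exE.
have [|g [Yg zg]] := @injective_extend R (E 1%N) Y z' e (injE _).
  by move=> r /(mulr_mem_max _ _ _ tY) /me.
(* The obstruction to [g] being a cocycle lies in Ext^2(R/(Y + Rz'), W) = 0. *)
have [|||f' f'0 df'] := van 0%N (adjoin Y z') j _ (delta 1%N g).
- exact: adjoin_sub.
- by apply/exE; exists g.
- move=> r /mem_adjoin [y yY [s ->]]; rewrite -linearZ /=.
  by rewrite scalerDl -scalerA Yg // zg add0r linearZ /= de scaler0.
have [chi hchi] : exists chi, delta 0%N chi = g - f'.
  by apply/exE; rewrite linearB /= df' subrr.
(* On [Y] both [g] and [f'] vanish, so [chi] induces a homomorphism from [Y] to W; the value of [w]
   outside [Y] is arbitrary. *)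
have /choice [w hw] : forall y : R, exists w, y \in Y -> eps w = y *: chi.
  move=> y; have [yY|] := boolP (y \in Y); last by exists 0.
  have [|w hw] := (exeps (y *: chi)).1; last by exists w.
  by rewrite linearZ /= hchi scalerBr Yg // f'0 ?subrr //; exact: adjoin_sub.
have [fi fiK fKi] := bijf.
pose kap y : R := val (fi (w y)).
have kapK y : kap y \in K by exact: valP.
have injf := bij_inj bijf.
(* By linearity [kap] is multiplication by the fraction [kap (x ^+ j)] over [x ^+ j]. *)
have kapE y : y \in Y -> kap (x ^+ j) * y = x ^+ j * kap y.
  move=> yY; rewrite mulrC /kap -!ideal_valZ; congr (val _); apply: injf.
  by rewrite !linearZ /= !fKi; apply: injeps; rewrite !linearZ /= !hw // !scalerA mulrC.
have [|k' kK' hk'] := hz' (kap (x ^+ j)) (kapK _).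
  by move=> y yY; exists (kap y) => //; exact: kapE.
(* An extension of [kap] to [z'] with value [k'] makes [e] a coboundary: the difference of the two
   candidate values at [z'] is killed by [m] and maps to [e]. *)
apply: ne; exists (z' *: chi - eps (f (SubmodElt kK'))); last first.
  rewrite linearB linearZ /= hchi scalerBr zg f'0 ?subr0; last exact: adjoin_gen.
  rewrite (_ : delta 0%N (eps _) = 0) ?subr0 //.
  by apply/exeps; exists (f (SubmodElt kK')).
move=> r rm; rewrite scalerBr scalerA -hw; last exact: mtY.
rewrite -linearZ -linearZ -linearB /= -[RHS](linear0 eps); congr (eps _).
rewrite -[w _]fKi -linearB -[RHS](linear0 f); congr (f _); apply/val_inj.
have : kap (r * z') = r * k'.
  apply: (lregX (n := j) regx); rewrite -kapE; last exact: mtY.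
  by rewrite mulrCA hk' mulrCA.
rewrite linearB /= => h; rewrite -[LHS]/(kap (r * z') - r * k' : R).
by rewrite h subrr.
Qed.

End Duality.

(** * Ulrich ideals *)

Section SpanIdeal.
Context {R : comNzRingType} {n : nat} (X : 'I_n -> R).

Fact span_ideal0 : exists c : 'I_n -> R, 0 = \sum_(i < n) c i * X i.
Proof. by exists (fun=> 0); rewrite big1 // => i _; rewrite mul0r. Qed.

Fact span_idealP (a u v : R) :
  (exists c : 'I_n -> R, u = \sum_(i < n) c i * X i) ->
  (exists c : 'I_n -> R, v = \sum_(i < n) c i * X i) ->
  exists c : 'I_n -> R, a * u + v = \sum_(i < n) c i * X i.
Proof.
move=> [c ->] [c' ->]; exists (fun i => a * c i + c' i).
rewrite mulr_sumr -big_split; apply: eq_bigr => i _ /=; ring.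
Qed.

Definition span_ideal : ideal R := @mk_submod R R^o
  (fun v : R => exists c : 'I_n -> R, v = \sum_(i < n) c i * X i)
  span_ideal0 span_idealP.

Lemma mem_span_ideal (v : R) :
  v \in span_ideal <-> exists c : 'I_n -> R, v = \sum_(i < n) c i * X i.
Proof. exact: mem_mk_ideal. Qed.

Lemma span_ideal_gen i : X i \in span_ideal.
Proof.
apply/mem_span_ideal; exists (fun j => if j == i then 1 else 0).
rewrite (bigD1 i) //= eqxx mul1r big1 ?addr0 // => j /negPf ->.
by rewrite mul0r.
Qed.

End SpanIdeal.

(** For regular [x] in [I], this says that the fractions I / x form a ring. *)
Definition square_eq {R : comNzRingType} (x : R) (I : ideal R) :=
  forall a b : R, a \in I -> b \in I -> exists2 w : R, w \in I & a * b = x * w.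

Lemma ideal_exp2_scale {R : comNzRingType} (x : R) (I : ideal R) : x \in I ->
  (ideal_exp I 2 =i scale_submod x I) <-> square_eq x I.
Proof.
move=> xI; split=> [h a b aI bI|sq].
  apply/mem_scale; rewrite -h; apply: mem_ideal_mul => //.
  by rewrite -[b]mulr1; apply: mem_ideal_mul => //; exact: ideal_exp0.
move=> v; apply/idP/idP.
  move: v; apply: ideal_mul_sub => a b aI bI2; apply/mem_scale; apply: sq => //.
  by move: b bI2; apply: ideal_mul_sub => b r bI _; exact: idealMr.
move=> /mem_scale [w wI ->]; apply: mem_ideal_mul => //.
by rewrite -[w]mulr1; apply: mem_ideal_mul => //; exact: ideal_exp0.
Qed.

(* The X i / x form a basis of A = I / x modulo I with X i0 / x = 1. *)
Definition ulrich_basis {R : comNzRingType} (I : ideal R) (x : R) {n}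
    (i0 : 'I_n) (X : 'I_n -> R) :=
  [/\ X i0 = x, forall i, X i \in I,
      forall v : R, v \in I -> exists c : 'I_n -> R, v = \sum_(i < n) c i * X i
    & forall (c : 'I_n -> R) (w : R), w \in I -> \sum_(i < n) c i * X i = x * w ->
        forall i, c i \in I].

Section Ulrich.
Context {R : comNzRingType} {m : ideal R}.
Context (hN : noetherian R) (hloc : local_ring m).
Context {x : R} {I : ideal R} (regx : GRing.lreg x) (xI : x \in I).
Context (sqI : square_eq x I) (Im : m_primary m I).

Lemma primary_sub_max (r : R) : r \in I -> r \in m.
Proof. by move=> rI; apply/(Im.2 r); exists 1%N; rewrite expr1. Qed.

Lemma one_notin_primary : 1 \notin I.
Proof. by case: Im => -[]. Qed.

Lemma primary_nil : nil_mod m x.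
Proof.
move=> r /(Im.2 r) [n rn] j; have [w _ hw] := sqI _ _ rn rn.
exists ((n + n) * j)%N, (w ^+ j).
by rewrite exprM exprD hw exprMn.
Qed.

(** A basis of I / I^2 lifts to [Y]. Some coefficient of [x] is a unit, so [x] can replace that
    [Y i0]; since I^2 = xI, the new family generates [I] itself, which bounds the minimal number of
    generators by [n]. *)
Lemma exists_ulrich_basis :
  free_over I (quotmod (restr_submod I (ideal_exp I 2%N))) ->
  exists n (i0 : 'I_n) (X : 'I_n -> R), ulrich_basis I x i0 X /\
    forall k, min_gens (submod_type I) k -> (k <= n)%N.
Proof.
move=> [_ [n [e [hspan hfree]]]]; exists n.
have sq2 := (ideal_exp2_scale x I xI).2 sqI.
have /choice [u hu] : forall i, exists u : submod_type I,
    e i = quot_proj (restr_submod I (ideal_exp I 2%N)) u by move=> i; exact: quot_projP.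
pose Y i : R := val (u i).
have YI i : Y i \in I by exact: valP.
have val_comb (c : 'I_n -> R) : (val (\sum_(i < n) c i *: u i) : R) = \sum_(i < n) c i * Y i.
  by rewrite ideal_val_sum; apply: eq_bigr => i _.
have proj_comb (c : 'I_n -> R) :
    \sum_(i < n) c i *: e i = quot_proj _ (\sum_(i < n) c i *: u i).
  by rewrite linear_sum; apply: eq_bigr => i _; rewrite linearZ hu.
have in_restr (w : submod_type I) :
    w \in restr_submod I (ideal_exp I 2%N) <-> (val w : R) \in ideal_exp I 2%N.
  exact: (iff_sym (rwP (asboolP _))).
have gen (v : R) : v \in I -> exists (c : 'I_n -> R) (w : R),
    w \in I /\ v = \sum_(i < n) c i * Y i + x * w.
  move=> vI; have [c] := hspan (quot_proj _ (SubmodElt vI)).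
  rewrite proj_comb => /quot_projE /in_restr; rewrite sq2 => /mem_scale [w wI hw].
  exists c, w; split=> //; rewrite -val_comb -hw.
  by rewrite -[v]/(val (SubmodElt vI) : R) linearB /= addrC subrK.
have free (c : 'I_n -> R) (w : R) : w \in I -> \sum_(i < n) c i * Y i = x * w ->
    forall i, c i \in I.
  move=> wI hw; apply: hfree; rewrite proj_comb.
  rewrite -[RHS](linear0 (@quot_proj _ _ (restr_submod I (ideal_exp I 2%N)))).
  apply/quot_projE/in_restr; rewrite subr0 val_comb hw sq2; apply/mem_scale.
  by exists w.
have [c [w [wI hx]]] := gen x xI.
have [i0 ci0] : exists i0, c i0 \notin m.
  (* If all coefficients lay in [m], a socle element [s] modulo [I] would send them into [I]; then s
     x lies in xI and [s] in [I]. *)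
  apply: contrapT => h; have cm i : c i \in m.
    by apply: contrapT => /negP ci; apply: h; exists i.
  have [|s] := socle_elt hN x primary_nil I 1 1 _ one_notin_primary.
    by rewrite expr1.
  rewrite mulr1 => -[/negP sI ms]; apply: sI.
  have /choice [w' hw'] : forall i, exists w', w' \in I /\ c i * s * Y i = x * w'.
    by move=> i; have [w' ? ?] := sqI _ _ (ms _ (cm i)) (YI i); exists w'.
  rewrite (_ : s = \sum_(i < n) w' i + s * w).
    apply: idealD; last exact: idealM.
    by apply: ideal_sum => i _; exact: (hw' i).1.
  apply: regx; rewrite mulrDr mulr_sumr -(eq_bigr _ (fun i _ => (hw' i).2)).
  rewrite {1}hx mulrDl mulr_suml; congr (_ + _); last ring.
  by apply: eq_bigr => i _; rewrite mulrAC.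
exists i0; pose X i := if i == i0 then x else Y i.
have Xi0 : X i0 = x by rewrite /X eqxx.
have XI i : X i \in I by rewrite /X; case: ifP.
have XY i : i != i0 -> X i = Y i by rewrite /X => /negPf->.
have xS : x \in span_ideal X by rewrite -Xi0; exact: span_ideal_gen.
have YS i : Y i \in span_ideal X.
  have [->|ii0] := eqVneq i i0; last by rewrite -XY //; exact: span_ideal_gen.
  apply: local_mem_cancel hN hloc _ _ _ ci0 _.
  rewrite (_ : _ * _ = x - (\sum_(i < n | i != i0) c i * Y i + x * w)).
    apply: idealB => //; apply: idealD; last exact: idealMr.
    apply: ideal_sum => k ki0; apply: idealM; rewrite -XY //; exact: span_ideal_gen.
  by rewrite {1}hx (bigD1 i0) //=; ring.
have genX (v : R) : v \in I -> exists d : 'I_n -> R, v = \sum_(i < n) d i * X i.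
  move=> /gen [d [w' [wI' ->]]]; apply/mem_span_ideal; apply: idealD.
    by apply: ideal_sum => i _; exact: idealM.
  exact: idealMr.
exists X; split; first split=> //.
  move=> d w' wI' hd.
  (* The coefficients on [Y] after [x] is replaced by its expression [hx]. *)
  have h i : (if i == i0 then d i0 * c i0 else d i + d i0 * c i) \in I.
    apply: (free (fun i => if i == i0 then d i0 * c i0 else d i + d i0 * c i)
              (w' - d i0 * w)); first by apply: idealB => //; exact: idealM.
    pose S1 := \sum_(i < n | i != i0) d i * X i.
    pose S2 := \sum_(i < n | i != i0) c i * Y i.
    have hd' : x * w' = d i0 * x + S1 by rewrite -hd (bigD1 i0) //= Xi0.
    have hx' : d i0 * x = d i0 * (c i0 * Y i0 + S2 + x * w).
      by rewrite {1}hx (bigD1 i0).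
    transitivity (d i0 * c i0 * Y i0 + (S1 + d i0 * S2)); last first.
      by rewrite mulrBr hd' hx'; ring.
    rewrite (bigD1 i0) //= eqxx mulr_sumr -big_split; congr (_ + _).
    apply: eq_bigr => k ki0 /=; rewrite (negPf ki0) XY //; ring.
  have d0 : d i0 \in I.
    by have := h i0; rewrite eqxx mulrC; exact: (local_mem_cancel hN hloc _ _ _ ci0).
  move=> i; have := h i; case: eqVneq => [-> //|_].
  by rewrite addrC; apply: ideal_addl; exact: idealMr.
move=> k [_ /(_ n (fun i => SubmodElt (XI i)))]; apply => v.
 have [d hd] := genX _ (valP v); exists d; apply/val_inj.
rewrite -[LHS]/(val v : R) hd ideal_val_sum; exact: eq_bigr.
Qed.

Section Basis.
Context (hdim : krull_dim R 1%N) {n : nat} {i0 : 'I_n} {X : 'I_n -> R}.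
Context (basX : ulrich_basis I x i0 X).

(* R : A = I *)
Lemma ulrich_colon (i : 'I_n) (r t : R) : i != i0 -> r * X i = x * t -> r \in I.
Proof.
move=> ii0 h; case: basX => Xi0 XI _ free.
pose c k := if k == i then r else if k == i0 then - t else 0.
have := free c 0 (ideal0 _) _ i; rewrite /c eqxx; apply.
have i0i : i0 != i by rewrite eq_sym.
rewrite (bigD1 i) //= eqxx (bigD1 i0) //= (negPf i0i) eqxx.
rewrite big1 ?addr0; last by move=> k /andP[/negPf-> /negPf->]; rewrite mul0r.
by rewrite Xi0 h; ring.
Qed.

Section Canonical.
Context {K : ideal R} (canK : canonical_ideal m K).

Lemma ulrich_reflexive (Y : ideal R) j (z : R) : x ^+ j \in Y ->
  (forall k : R, k \in K ->
    (forall y : R, y \in Y -> exists2 k' : R, k' \in K & k * y = x ^+ j * k') ->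
    exists2 k' : R, k' \in K & k * z = x ^+ j * k') ->
  z \in Y.
Proof.
exact: (canonical_reflexive hN hloc x (primary_sub_max _ xI) regx primary_nil K Y j z hdim canK).
Qed.

(* K : K = R *)
Lemma canonical_endo (z : R) j :
  (forall k : R, k \in K -> exists2 k' : R, k' \in K & z * k = x ^+ j * k') ->
  exists r, z = x ^+ j * r.
Proof.
move=> h; apply/mem_principal; apply: (ulrich_reflexive _ j).
  by apply/mem_principal; exists 1; rewrite mulr1.
by move=> k kK _; rewrite mulrC; exact: h.
Qed.

(** A multiplier k / x^(j+1) of [Y] into [K] sends [x] and [X i1] into K : K = R. So it equals r / x
    with r X i1 / x in R, whence [r] is in [I]; it then carries c X i2 into [K], and reflexivity
    applies. *)
Lemma canonical_sub_ulrich j : x ^+ j \in K -> (2 < n)%N -> {subset K <= I}.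
Proof.
move=> xK n2 c cK; case: basX => Xi0 XI gen free.
have /card_gt1P [i1 [i2 [/= i1i0 i2i0 i12]]] : (1 < #|predC1 i0|)%N.
  by rewrite cardC1 card_ord; case: n n2 => [|[|[|]]].
have hY := mem_pair_ideal K x (X i1); set Y := pair_ideal K x (X i1) in hY.
have : c * X i2 \in Y.
  apply: (ulrich_reflexive _ j.+1).
    apply/hY; exists (x ^+ j), 0; split; rewrite ?ideal0 // exprS; ring.
  move=> k kK kY; have [|r hr] := canonical_endo (k * x) j.+1.
    move=> l lK; have [|l' lK' hl] := kY (x * l); last by exists l'; rewrite // -mulrA.
    by apply/hY; exists l, 0; split; rewrite ?ideal0 //; ring.
  have kr : k = x ^+ j * r by apply: regx; rewrite mulrC hr exprS mulrA.
  have [|t ht] := canonical_endo (k * X i1) j.+1.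
    move=> l lK; have [|l' lK' hl] := kY (X i1 * l); last by exists l'; rewrite // -mulrA.
    by apply/hY; exists 0, l; split; rewrite ?ideal0 //; ring.
  have rI : r \in I.
    apply: (ulrich_colon i1 r t i1i0); apply: (lregX (n := j) regx).
    by rewrite mulrA -kr ht exprSr mulrA.
  have [w wI hw] := sqI _ _ rI (XI i2); exists (w * c); first exact: idealM.
  transitivity (x ^+ j * c * (r * X i2)); first by rewrite kr; ring.
  by rewrite hw exprSr; ring.
move=> /hY [k [k' [_ _ hc]]].
pose d i := if i == i2 then c else if i == i1 then - k' else if i == i0 then - k else 0.
have := free d 0 (ideal0 _) _ i2; rewrite /d eqxx; apply.
have [i0i1 i0i2] : i0 != i1 /\ i0 != i2 by split; rewrite eq_sym.
rewrite (bigD1 i2) //= eqxx (bigD1 i1) //= (negPf i12) eqxx.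
rewrite (bigD1 i0) /= ?i0i1 ?i0i2 // (negPf i0i1) (negPf i0i2) eqxx.
rewrite big1; last by move=> i /andP[/andP[/negPf-> /negPf->] /negPf->]; rewrite mul0r.
by rewrite Xi0 hc; ring.
Qed.

End Canonical.
End Basis.
End Ulrich.

(** * General elements *)

Section GeneralElement.
Context {R : comNzRingType} {m : ideal R}.
Context (hN : noetherian R) (hloc : local_ring m).
Context (hinf : infinite_set [set: quotmod m]).

Lemma incongruent_seq : exists t : nat -> R, forall i j, i != j -> t i - t j \notin m.
Proof.
have /infiniteP/card_leP [f] := hinf.
pose g (i : nat) : quotmod m := val (f (SigSub (in_setT i))).
have injg : injective g.
  move=> i j /val_inj /(@inj _ _ _ f) h.
  by have := congr1 val (h (in_setT _) (in_setT _)).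
have /choice [t ht] : forall i : nat, exists r : R, g i = quot_proj m r.
  by move=> i; have [r hr] := quot_projP (g i); exists r.
exists t => i j; apply: contra => h; apply/eqP/injg.
by rewrite !ht; apply/quot_projE.
Qed.

Context {x : R} {M K : ideal R} (regx : GRing.lreg x).
Context (hM : forall a v : R, a \in m -> v \in M -> exists2 w : R, w \in M & a * v = x * w).
Context (Km : {subset K <= m}).

(* The elements of m act on M / mM by v |-> a v / x; powers of
   x clear the denominators, so XP k stands for the zero submodule in degree k. *)
Let P : ideal R := ideal_mul m M.
Let XP k : ideal R := scale_submod (x ^+ k) P.

Let mulXP a k (y : R) : a \in m -> y \in XP k -> a * y \in XP k.+1.
Proof.
move=> am /mem_scale [p pP ->].
have h : {subset P <= colon (scale_submod x P) a}.
  apply: ideal_mul_sub => b v bm vM; apply/mem_colon.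
  have [w wM hw] := hM _ _ am vM; apply/mem_scale; exists (b * w).
    exact: mem_ideal_mul.
  rewrite (_ : _ * _ = b * (a * v)); last ring.
  by rewrite hw; ring.
have /mem_colon/mem_scale [p' pP' hp] := h _ pP.
apply/mem_scale; exists p' => //.
by rewrite mulrCA [a * p]mulrC hp exprSr mulrA.
Qed.

Let XP0 (v : R) : v \in XP 0 <-> v \in P.
Proof.
split=> [/mem_scale [p pP ->]|vP]; first by rewrite mul1r.
by apply/mem_scale; exists v; rewrite ?mul1r.
Qed.

Let XPD k l (y : R) : x ^+ k * y \in XP (k + l) <-> y \in XP l.
Proof.
split=> /mem_scale [p pP hp]; apply/mem_scale; exists p => //.
  by apply: (lregX (n := k) regx); rewrite hp exprD mulrA.
by rewrite hp exprD mulrA.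
Qed.

Let powXP a l k (y : R) : a \in m -> y \in XP k -> a ^+ l * y \in XP (l + k).
Proof.
move=> am yP; elim: l => [|l IHl]; first by rewrite mul1r.
by rewrite exprS -mulrA; exact: mulXP.
Qed.

Let pow_div a k (v : R) : a \in m -> v \in M ->
  exists2 w : R, w \in M & a ^+ k * v = x ^+ k * w.
Proof.
move=> am vM; elim: k => [|k [w wM hw]]; first by exists v.
have [w' wM' hw'] := hM _ _ am wM; exists w' => //.
by rewrite exprS -mulrA hw mulrCA hw' exprSr mulrA.
Qed.

(** In terms of the operators on M / mM: [v] lies in the generalised kernel of [b]; then, in
    [kills], the kernel of [c] lies in the generalised kernel of [b]. *)
Let nil (b v : R) := exists k, b ^+ k * v \in XP k.
Let kills (c b : R) := forall v : R, v \in M -> c * v \in XP 1 -> nil b v.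

(** The operators commute: a power of [b] kills the image of [v] under a^k, so a^k kills the image
    of [v] under that power, and induction on [k] applies. *)
Let kills_nil a b k (v : R) : a \in m -> b \in m -> kills a b -> v \in M ->
  a ^+ k * v \in XP k -> nil b v.
Proof.
move=> am bm ab; elim: k v => [|k IHk] v vM hv.
  by exists 0%N; rewrite expr0 -[1](expr0 a).
have [w wM hw] := pow_div a k v am vM.
have [l hl] : nil b w.
  apply: ab => //; apply/(XPD k); rewrite addn1 mulrCA -hw mulrA -exprS //.
have [v' vM' hv'] := pow_div b l v bm vM.
have [l' hl'] : nil b v'.
  apply: IHk => //; apply/(XPD l).
  by rewrite mulrCA -hv' mulrCA hw mulrCA addnC; apply/XPD.
exists (l + l')%N; rewrite exprD (_ : _ * v = b ^+ l' * (b ^+ l * v)); last ring.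
by rewrite hv' mulrCA; apply/XPD.
Qed.

(* If each c i = a + t i * b kills some v i on which b is not nilpotent, take q with
   v q a combination of the v i, i < q: the product of the c i, i < q, kills v q,
   but acts on it as the unit \prod_(i < q) (t i - t q) times b ^+ q. *)
Let kills_pair a b : a \in K -> b \in K -> exists c, [/\ c \in K, kills c a & kills c b].
Proof.
move=> aK bK; have [t ht] := incongruent_seq.
have am := Km _ aK; have bm := Km _ bK.
pose c i := a + t i * b.
have cK i : c i \in K by apply: idealD => //; exact: idealM.
have cm i : c i \in m by exact: Km.
(* On the kernel of [c i] the operator [a] is - t i times [b], hence nilpotent with [b]. *)
suff [i hi] : exists i, kills (c i) b.
  exists (c i); split=> // v vM cv; have [k hk] := hi v vM cv; exists k.
  suff h l : a ^+ l * v - (- t i) ^+ l * (b ^+ l * v) \in XP l.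
    have := h k; rewrite addrC; apply: ideal_addl; apply: idealN; exact: idealM.
  elim: l => [|l IHl]; first by rewrite !expr0 !mul1r subrr; exact: ideal0.
  rewrite (_ : _ - _ = a * (a ^+ l * v - (- t i) ^+ l * (b ^+ l * v))
    + (- t i) ^+ l * (b ^+ l * (c i * v))); last by rewrite /c !exprS; ring.
  apply: idealD; first exact: mulXP.
  by apply: idealM; rewrite -[l.+1]addn1; exact: powXP.
apply: contrapT => hno.
have /choice [v hv] : forall i, exists v : R, [/\ v \in M, c i * v \in XP 1 & ~ nil b v].
  move=> i; apply: contrapT => h; apply: hno; exists i => v vM cv.
  by apply: contrapT => nv; apply: h; exists v.
have [q [s hs]] := noetherian_seq hN v.
have prodS (g : nat -> R) l : \prod_(j < l.+1) g j = (\prod_(j < l) g j) * g l.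
  by rewrite big_ord_recr.
have prodXP l k (y : R) : y \in XP k -> (\prod_(j < l) c j) * y \in XP (l + k).
  move=> yP; elim: l => [|l IHl]; first by rewrite big_ord0 mul1r.
  by rewrite prodS [_ * c l]mulrC -mulrA; exact: mulXP.
have kill l i : (i < l)%N -> (\prod_(j < l) c j) * v i \in XP l.
  elim: l => // l IHl; rewrite ltnS leq_eqVlt prodS => /orP[/eqP->|/IHl h].
    by rewrite -mulrA -addn1; apply: prodXP; have [] := hv l.
  by rewrite [_ * c l]mulrC -mulrA; exact: mulXP.
(* On the kernel of [c q] each [c j] acts as (t j - t q) b. *)
have expand l : (\prod_(j < l) c j) * v q
    - (\prod_(j < l) (t j - t q)) * (b ^+ l * v q) \in XP l.
  elim: l => [|l IHl]; first by rewrite !big_ord0 expr0 !mul1r subrr; exact: ideal0.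
  rewrite prodS (prodS (fun j => t j - t q)).
  move: (\prod_(j < l) c j) (\prod_(j < l) (t j - t q)) IHl => pc pu IHl.
  rewrite (_ : _ - _ = c l * (pc * v q - pu * (b ^+ l * v q))
    + pu * (b ^+ l * (c q * v q))); last by rewrite /c exprS; ring.
  apply: idealD; first exact: mulXP.
  by apply: idealM; rewrite -[l.+1]addn1; apply: powXP => //; have [] := hv q.
have [_ _] := hv q; apply; exists q.
have um : \prod_(j < q) (t j - t q) \notin m.
  elim/big_ind: _ => [|r r'|j _]; first exact: one_notin_max.
    exact: (max_notinM hN hloc).
  by apply: ht; rewrite neq_ltn ltn_ord.
apply: (local_mem_cancel hN hloc _ _ _ um).
apply: (ideal_addl _ (- ((\prod_(j < q) c j) * v q))); last first.
  by rewrite addrC -opprB; apply: idealN; exact: expand.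
rewrite {1}hs mulr_sumr; apply: idealN; apply: ideal_sum => i _.
by rewrite mulrCA; apply: idealM; exact: kill.
Qed.

(** One element is absorbed at a time by [kills_pair]; [kills_nil] provides the transitivity. *)
Let kills_seq (s : seq R) : (forall k, k \in s -> k \in K) ->
  exists2 c, c \in K & forall k, k \in s -> kills c k.
Proof.
elim: s => [|k s IHs] hs; first by exists 0; rewrite ?ideal0.
have [|c' cK' hc'] := IHs; first by move=> l ls; apply: hs; rewrite inE ls orbT.
have kK : k \in K by apply: hs; rewrite mem_head.
have [c [cK cc' ck]] := kills_pair c' k cK' kK; exists c => // l.
rewrite inE => /orP[/eqP-> //|ls] v vM cv; have [N hN'] := cc' v vM cv.
apply: (kills_nil c' l N) => //; [exact: Km | | exact: hc'].
by apply: Km; apply: hs; rewrite inE ls orbT.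
Qed.

(** Commuting operators nilpotent at a nonzero class have a common kernel: [v] is replaced by its
    last nonzero image under each [k]. The final clause keeps what was already killed. *)
Let nil_annihilated (s : seq R) (v : R) : v \in M -> v \notin P ->
  (forall k, k \in s -> k \in m /\ nil k v) ->
  exists v' : R, [/\ v' \in M, v' \notin P, forall k, k \in s -> k * v' \in XP 1
    & forall k, k \in m -> k * v \in XP 1 -> k * v' \in XP 1].
Proof.
elim: s v => [|k s IHs] v vM vP hs; first by exists v.
have [km exk] := hs k (mem_head _ _).
case: (ex_minnP exk) => -[|N] hk minN.
  by rewrite expr0 mul1r in hk; move: vP; rewrite (XP0 v).1.
have [w wM hw] := pow_div k N v km vM.
have transfer l L : l \in m -> l ^+ L * v \in XP L -> l ^+ L * w \in XP L.
  by move=> lm hl; apply/(XPD N); rewrite mulrCA -hw mulrCA; exact: powXP.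
have [||v' [vM' vP' hv' tv']] := IHs w wM.
- apply/negP => wP; have := minN N; rewrite ltnn hw => h.
  by apply: (Bool.diff_false_true); apply: h; rewrite -[N in XP N]addn0; apply/XPD/XP0.
- move=> l ls; have [|lm [L hL]] := hs l; first by rewrite inE ls orbT.
  by split=> //; exists L; exact: transfer.
exists v'; split=> //.
  move=> l; rewrite inE => /orP[/eqP->|/hv' //].
  apply: tv' => //; apply/(XPD N).
  by rewrite mulrCA -hw mulrA -exprS addn1.
move=> l lm hl; apply: tv' => //.
by have := transfer l 1%N lm; rewrite expr1; apply.
Qed.

(** By hypothesis the operators in [s] have no common kernel on M / mM. A [c] from [kills_seq] is
    then injective there, hence surjective by finiteness, and Nakayama lifts this to xM inside
    cM. *)
Lemma general_element (s : seq R) :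
  (forall k, k \in s -> k \in K) ->
  (forall v : R, v \in M ->
     (forall k, k \in s -> exists2 p : R, p \in ideal_mul m M & k * v = x * p) ->
     v \in ideal_mul m M) ->
  exists2 c, c \in K &
    forall v : R, v \in M -> exists2 w : R, w \in M & x * v = c * w.
Proof.
move=> sK hs; have XP1 (y : R) : y \in XP 1 <-> exists2 p : R, p \in P & y = x * p.
  by rewrite /XP expr1; exact: mem_scale.
have [c cK hc] := kills_seq s sK; exists c => //; have cm := Km _ cK.
have injc (v : R) : v \in M -> c * v \in XP 1 -> v \in P.
  move=> vM cv; apply: contrapT => /negP vP.
  have [|v' [vM' /negP vP' hv' _]] := nil_annihilated s v vM vP.
    by move=> k ks; split; [exact/Km/sK | exact: hc].
  by apply: vP'; apply: hs => // k ks; apply/XP1; exact: hv'.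
have /choice [f hf] : forall v : R, exists w : R, v \in M -> w \in M /\ c * v = x * w.
  move=> v; have [vM|_] := boolP (v \in M); last by exists 0.
  by have [w ? ?] := hM _ _ cm vM; exists w.
(* If c were not onto, the elements u, cu, ccu, ... would be independent. *)
have step (u : R) : u \in M -> exists w w' : R,
    [/\ w \in M, w' \in M, c * w = x * w' & u - w' \in P].
  move=> uM; pose U i := iter i f u.
  have UM i : U i \in M by elim: i => //= i /hf [].
  have US i : c * U i = x * U i.+1 by exact: (hf _ (UM i)).2.
  (* In a relation among the iterates, a constant coefficient in [m] lets one cancel [c] by
     injectivity; a unit one exhibits [u] as an image of [c]. *)
  suff H L (r : nat -> R) : \sum_(i < L.+1) r i * U i \in P -> r L \notin m ->
      exists w w' : R, [/\ w \in M, w' \in M, c * w = x * w' & u - w' \in P].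
    have [q [r hr]] := noetherian_seq hN U.
    apply: (H q (fun i => if i == q then -1 else r i)).
      rewrite (_ : \sum_(i < q.+1) _ = 0); first exact: ideal0.
      rewrite big_ord_recr /= eqxx mulN1r hr.
      rewrite (eq_bigr (fun i : 'I_q => r i * U i)) ?subrr // => i _.
      by rewrite ltn_eqF.
    by rewrite eqxx; apply: contra (one_notin_max hloc) => /idealN; rewrite opprK.
  elim: L r => [|L IHL] r.
    rewrite big_ord1 => rU /(local_mem_cancel hN hloc) h; exists 0, 0.
    by rewrite !mulr0 subr0 !ideal0; split=> //; exact: h.
  rewrite big_ord_recl => hsum rL.
  pose w := \sum_(i < L.+1) r i.+1 * U i.
  pose w' := \sum_(i < L.+1) r i.+1 * U i.+1.
  have wM : w \in M by apply: ideal_sum => i _; exact: idealM.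
  have wM' : w' \in M by apply: ideal_sum => i _; apply: idealM; exact: (UM i.+1).
  have cw : c * w = x * w'.
    rewrite !mulr_sumr; apply: eq_bigr => i _.
    by rewrite mulrCA US mulrCA.
  have [r0|r0] := boolP (r 0%N \in m).
    apply: (IHL (fun i => r i.+1)) => //; apply: injc => //.
    rewrite -/w cw; apply/XP1; exists w' => //.
    by apply: ideal_addl hsum; exact: mem_ideal_mul.
  have [z hz] := local_unit hN hloc _ r0.
  exists (- z * w), (- z * w'); split; try exact: idealM.
    by rewrite mulrCA cw mulrCA.
  rewrite (_ : _ - _ = z * (r 0%N * u + w')); first exact: idealM.
  by rewrite mulrDr mulrA hz; ring.
have sub : {subset M <= colon (scale_submod c M) x}.
  apply: (nakayama hN hloc) => v /step [w [w' [wM wM' cw vw]]].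
  exists w', (v - w'); split=> //; last ring.
  by apply/mem_colon/mem_scale; exists w => //; rewrite mulrC cw.
by move=> v /sub/mem_colon/mem_scale [w wM hw]; exists w => //; rewrite mulrC.
Qed.

End GeneralElement.

(** * Replacing x by another element c with I^2 = cI *)

Section ChangeOfElement.
Context {R : comNzRingType} {x c : R} {I M : ideal R}.
Context (hN : noetherian R) (regx : GRing.lreg x) (xI : x \in I) (cI : c \in I).
Context (sqI : square_eq x I).

(* x / c preserves M, hence is integral over R; as c / x lies in A = I / x, the
   equation of integrality puts x / c itself in A. *)
Lemma square_mem_scale N : x ^+ N \in M ->
  (forall v : R, v \in M -> exists2 w : R, w \in M & x * v = c * w) ->
  exists2 w : R, w \in I & x * x = c * w.
Proof.
move=> xM hM.
have /choice [f hf] : forall v : R, exists w : R, v \in M -> w \in M /\ x * v = c * w.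
  move=> v; have [vM|_] := boolP (v \in M); last by exists 0.
  by have [w ? ?] := hM _ vM; exists w.
pose V i := iter i f (x ^+ N).
have VM i : V i \in M by elim: i => //= i /hf [].
have VE i : c ^+ i * V i = x ^+ i * x ^+ N.
  elim: i => // i IHi; rewrite exprSr -mulrA -(hf _ (VM i)).2 mulrCA IHi.
  by rewrite mulrA -exprS.
have [q [s hs]] := noetherian_seq hN V.
(* The equation of integral dependence of x / c, with denominators cleared; here [V i] stands for (x
   / c)^i x^N. *)
have eqx : x ^+ q = \sum_(i < q) s i * (c ^+ (q - i) * x ^+ i).
  apply: (lregX (n := N) regx); rewrite mulrC -VE hs !mulr_sumr.
  apply: eq_bigr => i _.
  rewrite -{1}(subnK (ltnW (ltn_ord i))) exprD.
  rewrite (_ : _ * _ = s i * c ^+ (q - i) * (c ^+ i * V i)); last ring.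
  by rewrite VE; ring.
(* That is, (c / x)^a lies in A. *)
have pow a : exists2 w : R, w \in I & x * c ^+ a = x ^+ a * w.
  elim: a => [|a [w wI hw]]; first by exists x; rewrite // expr0 mulrC.
  have [w' wI' hw'] := sqI _ _ wI cI; exists w' => //.
  by rewrite exprSr mulrA hw -mulrA hw' mulrA -exprSr.
case: q hs eqx => [|q] hs.
  by rewrite big_ord0 expr0 => /eqP; rewrite oner_eq0.
move=> eqx; have /choice [w hw] : forall i : 'I_q.+1, exists w : R,
    w \in I /\ x * (c ^+ (q.+1 - i) * x ^+ i) = x ^+ q * (c * w).
  move=> i; have [w wI hw] := pow (q - i)%N; exists w; split=> //.
  have iq : (i <= q)%N by rewrite -ltnS.
  rewrite subSn // exprS.
  rewrite (_ : _ * _ = c * (x * c ^+ (q - i)) * x ^+ i); last ring.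
  have -> : x ^+ q = x ^+ (q - i) * x ^+ i by rewrite -exprD subnK.
  by rewrite hw; ring.
exists (\sum_(i < q.+1) s i * w i).
  by apply: ideal_sum => i _; apply: idealM; exact: (hw i).1.
apply: (lregX (n := q) regx); rewrite mulrA -exprSr mulrC eqx !mulr_sumr.
apply: eq_bigr => i _; rewrite mulrCA (hw i).2; ring.
Qed.

(** The fraction x / c = w / x lies in A, so c / x is a unit of A and I = cA. *)
Lemma square_eq_change : (exists2 w : R, w \in I & x * x = c * w) ->
  GRing.lreg c /\ square_eq c I.
Proof.
move=> [w wI hw]; split.
  move=> a b h; apply: (lregX (n := 2) regx).
  by rewrite expr2 hw ![c * w]mulrC -!mulrA h.
move=> a b aI bI; have [u uI hu] := sqI _ _ aI bI.
have [u' uI' hu'] := sqI _ _ wI uI; exists u' => //.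
by rewrite hu; apply: regx; rewrite mulrA hw -mulrA hu' mulrCA.
Qed.

End ChangeOfElement.

(** * From a canonical ideal containing x to the generalized Gorenstein property *)

Section GeneralizedGorenstein.
Context {R : comNzRingType} {m : ideal R}.
Context (hN : noetherian R) (hloc : local_ring m) (hdim : krull_dim R 1%N).
Context {x : R} {I : ideal R} (regx : GRing.lreg x) (xI : x \in I).
Context (sqI : square_eq x I) (Im : m_primary m I).
Context {n : nat} {i0 : 'I_n} {X : 'I_n -> R} (basX : ulrich_basis I x i0 X).
Context (n2 : (2 < n)%N).
Context {K : ideal R} (canK : canonical_ideal m K) (xK : x \in K).

Let refl := @ulrich_reflexive R m hN hloc x I regx xI sqI Im hdim K canK.
Let endo := @canonical_endo R m hN hloc x I regx xI sqI Im hdim K canK.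

Let KI : {subset K <= I}.
Proof.
exact: (canonical_sub_ulrich hN hloc regx xI sqI Im hdim basX canK 1).
Qed.

(* K / x : A = I, where A = I / x *)
Lemma canonical_colon_ulrich (k : R) j :
  (forall y : R, y \in I -> exists2 l : R, l \in K & k * y = x ^+ j * l) ->
  exists2 i : R, i \in I & k = x ^+ j * i.
Proof.
move=> hk; have hy y : y \in I -> exists r, k * y = x ^+ j.+1 * r.
  move=> yI; apply: endo => l lK.
  have [w wI hw] := sqI _ _ yI (KI _ lK); have [l' lK' hl'] := hk _ wI.
  by exists l'; rewrite // -mulrA hw mulrCA hl' mulrA -exprS.
have [r hr] := hy _ xI.
have kr : k = x ^+ j * r by apply: regx; rewrite mulrC hr exprS mulrA.
exists r => //.
have /card_gt1P [i1 [_ [/= i1i0 _ _]]] : (1 < #|predC1 i0|)%N.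
  by rewrite cardC1 card_ord; case: (n) n2 => [|[|[|]]].
case: (basX) => _ XI _ _; have [t ht] := hy _ (XI i1).
apply: (ulrich_colon basX i1 r t i1i0); apply: (lregX (n := j) regx).
by rewrite mulrA -kr ht exprSr mulrA.
Qed.

(* R/I has a simple socle, hence is Gorenstein: the dual of (I + Rs) A into K / x
   is mA for every socle element s, so (I + Rs) A does not depend on s. *)
Lemma ulrich_socle (s s' : R) : s \notin I ->
  (forall r : R, r \in m -> r * s \in I) -> (forall r : R, r \in m -> r * s' \in I) ->
  exists t, s' - t * s \in I.
Proof.
move=> sI ms ms'; case: (basX) => Xi0 XI gen free.
have : x * s' \in pair_ideal I x s.
  apply: (refl _ 2).
    by apply/mem_pair_ideal; exists x, 0; rewrite ideal0 mulr0 addr0.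
  move=> k kK hk.
  have [|kap kapI hkap] := canonical_colon_ulrich k 1.
    move=> y yI; have [|l lK hl] := hk (x * y).
      by apply/mem_pair_ideal; exists y, 0; rewrite ideal0 mulr0 addr0.
    by exists l => //; apply: regx; rewrite mulrCA hl expr2 expr1 mulrA.
  have [|w wI hw] := canonical_colon_ulrich (k * s) 2.
    move=> y yI; have [|l lK hl] := hk (s * y); last by exists l; rewrite // -mulrA.
    by apply/mem_pair_ideal; exists 0, y; rewrite ideal0 mulr0 add0r.
  have [c hc] := gen _ kapI.
  (* Freeness puts each [s * c i] in [I], and [s] is not in [I]; so [s'] also sends the [c i] into
     [I]. *)
  have cm i : c i \in m.
    have : s * c i \in I.
      apply: (free (fun i => s * c i) w wI).
      apply: (lregX (n := 1) regx); rewrite [RHS]mulrA -expr2 -hw hkap -mulrA.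
      rewrite expr1 hc mulr_suml; congr (_ * _); apply: eq_bigr => k' _; ring.
    rewrite mulrC; exact: (mulr_mem_max hN hloc I s (c i) sI).
  have [w' wI' hw'] : exists2 w' : R, w' \in I & kap * s' = x * w'.
    have : kap * s' \in scale_submod x I.
      rewrite hc mulr_suml; apply: ideal_sum => i _; rewrite mulrAC.
      by apply/mem_scale; apply: sqI => //; exact: ms'.
    by move=> /mem_scale.
  exists (x * w'); first exact: idealMr.
  rewrite hkap expr1 -hw'; ring.
move=> /mem_pair_ideal [i [i' [iI iI' h]]]; have [b hb] := gen _ iI'.
(* Coefficients at [i0] are compared in x s' = x i + s i'. *)
exists (b i0).
have := free (fun k => if k == i0 then s' - b i0 * s else - (s * b k)) i iI _ i0.
rewrite eqxx; apply.
rewrite (bigD1 i0) //= eqxx Xi0.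
rewrite (eq_bigr (fun k => - (s * (b k * X k)))); last first.
  by move=> k /negPf->; ring.
rewrite sumrN -mulr_sumr.
move: h; rewrite hb (bigD1 i0) //= Xi0 => h.
transitivity (x * s' - s * (b i0 * x + \sum_(k < n | k != i0) b k * X k)); first ring.
by rewrite h; ring.
Qed.

Let exists_socle : exists s : R, s \notin I /\ forall r : R, r \in m -> r * s \in I.
Proof.
have [|s] := socle_elt hN x (primary_nil sqI Im) I 1 1 _ (one_notin_primary Im).
  by rewrite expr1.
by rewrite mulr1; exists s.
Qed.

Let xIK (y : R) : y \in I -> x * y \in K.
Proof. by move=> yI; exact: idealMr. Qed.

(* For w = K / x and e = X j / x, the socle of R/I being simple gives
   w : (w + Re) = I = w : A, whence A = w + Re. *)
Lemma canonical_cyclic : exists j : 'I_n, [/\ j != i0,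
   forall r : R, r * X j \in K -> r \in I
 & forall y : R, y \in I -> exists sg, y - sg * X j \in K].
Proof.
case: (basX) => Xi0 XI gen free; have [s [sI ms]] := exists_socle.
have [j sj] : exists j, s * X j \notin K.
  apply: contrapT => h; have hs i : s * X i \in K.
    by apply: contrapT => /negP hi; apply: h; exists i.
  have [|i iI] := canonical_colon_ulrich s 0; last first.
    by rewrite mul1r => si; move: sI; rewrite si iI.
  move=> y /gen [c ->]; exists (s * \sum_i c i * X i); last by rewrite mul1r.
  by rewrite mulr_sumr; apply: ideal_sum => i _; rewrite mulrCA; exact: idealM.
(* Otherwise some multiple of [r] is a unit times [s] modulo [I], and [s * X j] would lie in [K]. *)
have jI (r : R) : r * X j \in K -> r \in I.
  move=> rK; apply: contrapT => /negP rI.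
  have [|t [trI mtr]] := socle_elt hN x (primary_nil sqI Im) I r 1 _ rI.
    by rewrite expr1.
  have [u hu] := ulrich_socle s (t * r) sI ms mtr.
  have um : u \notin m.
    apply/negP => um; move: trI; rewrite -(subrK (u * s) (t * r)).
    by rewrite idealD // ms.
  move/negP: sj; apply; apply: (local_mem_cancel hN hloc _ _ _ um).
  rewrite (_ : _ * _ = t * (r * X j) - (t * r - u * s) * X j); last ring.
  apply: idealB; first exact: idealM.
  by have [w wI ->] := sqI _ _ hu (XI j); exact: xIK.
exists j; split=> //.
  by apply: contraNneq sj => ->; rewrite Xi0; exact: idealM.
move=> y yI; suff : y \in adjoin K (X j).
  by move=> /mem_adjoin [l lK [sg ->]]; exists sg; rewrite addrK.
apply: (refl _ 1); first by rewrite expr1; exact: adjoin_sub.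
move=> k kK hk; have [|r hr] := endo k 1.
  by move=> l lK; apply: hk; exact: adjoin_sub.
rewrite expr1 in hr.
have rI : r \in I.
  apply: jI; have [|l lK hl] := hk (X j); first exact: adjoin_gen.
  suff -> : r * X j = l by [].
  by apply: regx; rewrite mulrA -hr hl expr1.
have [w wI hw] := sqI _ _ rI yI; exists (x * w); first exact: xIK.
by rewrite expr1 hr -mulrA hw.
Qed.

(** The sequence is R -> K -> K / xR with 1 sent to [x]. Each [X i] is corrected into [K] by a
    multiple of [X j]; for [i] other than [i0] and [j] these form a basis of K / xR over R/I. *)
Lemma generalized_gorenstein_ulrich : generalized_gorenstein m I.
Proof.
case: (basX) => Xi0 XI gen free; have [j [ji0 jI cyc]] := canonical_cyclic.
have /choice [sg hsg] : forall i, exists sg, X i - sg * X j \in K.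
  by move=> i; exact: cyc.
pose Y i : submod_type K := SubmodElt (hsg i).
pose A := [pred i : 'I_n | (i != i0) && (i != j)].
have freeY (c : 'I_n -> R) (t : R) :
    \sum_(i in A) c i * (X i - sg i * X j) = x * t -> forall i, i \in A -> c i \in I.
  move=> h i /andP[ii0 ij].
  pose T := \sum_(i in A) c i * sg i.
  have := free (fun k => if k == i0 then - t else if k == j then - T else c k) 0
    (ideal0 _) _ i; rewrite (negPf ii0) (negPf ij); apply.
  rewrite (bigD1 i0) //= eqxx (bigD1 j) //= (negPf ji0) eqxx Xi0.
  rewrite (eq_bigr (fun k => c k * (X k - sg k * X j) + (c k * sg k) * X j)); last first.
    by move=> k /andP[/negPf-> /negPf->]; ring.
  by rewrite big_split -mulr_suml /= -/T h; ring.
(* As n > 2, the quotient is nonzero, and its annihilator is no larger than [I]. *)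
have [i1 i1A] : exists i, i \in A.
  have /card_gt0P [i iA] : (0 < #|[predC (pred2 i0 j)]|)%N.
    have := cardC (pred2 i0 j); rewrite card_ord card2 eq_sym ji0.
    by case: #|_| => // h; move: n2; rewrite -h.
  by exists i; move: iA; rewrite !inE negb_or.
pose S := restr_submod K (principal x).
have inS (v : submod_type K) : v \in S <-> exists r : R, (val v : R) = x * r.
  apply: iff_trans (mem_principal x (val v)); exact: (iff_sym (rwP (asboolP _))).
have q0 (v : submod_type K) : quot_proj S v = 0 <-> exists r : R, (val v : R) = x * r.
  rewrite -[in X in X <-> _](linear0 (@quot_proj _ _ S)).
  by apply: (iff_trans (quot_projE S v 0)); rewrite subr0; exact: inS.
pose x0 : submod_type K := SubmodElt xK.
have [|f hf] := @linear_intro R R^o (submod_type K) (fun r : R => r *: x0).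
  by move=> a u v /=; rewrite scalerDl scalerA.
have Iannih : annihilates I (quotmod S).
  move=> r rI w; have [v ->] := quot_projP w; rewrite -linearZ; apply/q0.
  rewrite ideal_valZ; have [t _ ->] := sqI _ _ rI (KI _ (valP v)); by exists t.
exists K, (quotmod S), f, (@quot_proj _ _ S); split=> //.
- split.
  + move=> r r'; rewrite !hf => /(congr1 (fun u : submod_type K => val u : R)).
    by rewrite !ideal_valZ ![_ * val x0]mulrC => /regx.
  + move=> v; apply: (iff_trans (q0 v)); split=> -[r hr]; exists r.
      by rewrite hf; apply/val_inj; rewrite [RHS]hr mulrC.
    by rewrite -hr hf ideal_valZ mulrC.
  + by move=> w; have [v ->] := quot_projP w; exists v.
- move=> r; split=> [rI w|hr]; first exact: Iannih.
  have := hr (quot_proj S (Y i1)); rewrite -linearZ => /q0 [t ht].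
  have := freeY (fun i => if i == i1 then r else 0) t _ i1 i1A; rewrite eqxx; apply.
  rewrite (bigD1 i1) //= eqxx big1 ?addr0; first exact: ht.
  by move=> i /andP[_ /negPf->]; rewrite mul0r.
split=> //; exists #|A|, (fun k => quot_proj S (Y (enum_val k))).
have sumE (c : 'I_n -> R) : \sum_(k < #|A|) c (enum_val k) *: quot_proj S (Y (enum_val k))
    = quot_proj S (\sum_(i in A) c i *: Y i).
  rewrite linear_sum (big_enum_val (fun i => quot_proj S (c i *: Y i))).
  by apply: eq_bigr => k _; rewrite linearZ.
have valE (c : 'I_n -> R) : (val (\sum_(i in A) c i *: Y i) : R)
    = \sum_(i in A) c i * (X i - sg i * X j).
  by rewrite (raddf_sum (val : submod_type K -> R^o)); apply: eq_bigr => i _.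
split.
  move=> w; have [v ->] := quot_projP w.
  have [r hr] := gen _ (KI _ (valP v)).
  exists (fun k => r (enum_val k)); rewrite sumE; apply/quot_projE/inS.
  rewrite -[val _]/((val v : R) - (val (\sum_(i in A) r i *: Y i) : R)) valE hr.
  (* The coefficient left at [X j]: it lies in [I], so [rho * X j] lies in xR. *)
  pose rho := r j + \sum_(i in A) r i * sg i.
  have e : \sum_(i < n) r i * X i - \sum_(i in A) r i * (X i - sg i * X j)
      = r i0 * x + rho * X j.
    rewrite (bigD1 i0) //= (bigD1 j) //= Xi0 /rho mulrDl mulr_suml -!addrA.
    congr (_ + (_ + _)); rewrite -sumrB; apply: eq_bigr => i _; ring.
  have rhoI : rho \in I.
    apply: jI; apply: (ideal_addl _ (r i0 * x)); first exact: idealM.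
    rewrite -e -hr -valE; apply: idealB; exact: valP.
  have [t _ ht] := sqI _ _ rhoI (XI j).
  by rewrite e ht; exists (r i0 + t); ring.
move=> c hc k.
(* Reindexes [c] from positions in [A] to indices, with 0 outside [A]. *)
pose c' i := if [pick k | enum_val k == i] is Some k then c k else 0.
have cE k' : c' (enum_val k') = c k'.
  rewrite /c'; case: pickP => [l /eqP/enum_val_inj -> //|/(_ k')].
  by rewrite eqxx.
rewrite -cE; have /q0 [t] : quot_proj S (\sum_(i in A) c' i *: Y i) = 0.
  by rewrite -sumE -[RHS]hc; apply: eq_bigr => l _; rewrite cE.
rewrite valE => /freeY; apply; exact: enum_valP.
Qed.

End GeneralizedGorenstein.

(** * Reductions of the maximal ideal *)

Section Reductions.
Context {R : comNzRingType} {m I K : ideal R} {x : R}.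
Context (hN : noetherian R) (hloc : local_ring m).
Context (hinf : infinite_set [set: quotmod m]).
Context (regx : GRing.lreg x) (xI : x \in I) (sqI : square_eq x I).
Context (Im : {subset I <= m}).

Lemma ideal_mul_mono (J J' L : ideal R) :
  {subset J <= J'} -> {subset ideal_mul J L <= ideal_mul J' L}.
Proof.
move=> JJ'; apply: ideal_mul_sub => a b aJ bL; apply: mem_ideal_mul => //.
exact: JJ'.
Qed.

(** m^(k+2) = I m^(k+1) = I^2 m^k = xI m^k, so [x] generates a reduction of [m]. *)
Lemma reduction_scale k :
  ideal_exp m k.+1 =i ideal_mul I (ideal_exp m k) ->
  forall a v : R, a \in m -> v \in ideal_exp m k.+1 ->
    exists2 w : R, w \in ideal_exp m k.+1 & a * v = x * w.
Proof.
move=> red a v am; rewrite red => vIm.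
suff h : {subset ideal_mul I (ideal_exp m k) <=
    colon (scale_submod x (ideal_exp m k.+1)) a}.
  by have /mem_colon/mem_scale [w wm hw] := h _ vIm; exists w; rewrite // mulrC.
apply: ideal_mul_sub => i u iI um; apply/mem_colon.
have : a * u \in ideal_exp m k.+1 by exact: mem_ideal_mul.
rewrite red (_ : i * u * a = a * u * i); last ring.
move=> auI; apply/mem_colon; move: (a * u) auI.
apply: ideal_mul_sub => i' u' iI' um'; apply/mem_colon.
have [w wI hw] := sqI _ _ iI iI'; apply/mem_scale; exists (w * u').
  by apply: mem_ideal_mul => //; exact: Im.
by rewrite mulrA -hw; ring.
Qed.

(** [general_element] is applied to M = m^(k+1) and the [kap j] in x^(k+1) = sum of kap j mu j. If
    every kap j v lies in xmM, then x^(k+1) v lies in x^(k+1) mM by [mP], so [v] is in mM. *)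
Lemma reduction_element k : {subset K <= I} ->
  ideal_exp m k.+1 =i ideal_mul K (ideal_exp m k) ->
  exists2 c : R, c \in K & forall v : R, v \in ideal_exp m k.+1 ->
    exists2 w : R, w \in ideal_exp m k.+1 & x * v = c * w.
Proof.
move=> KI redK.
have redI : ideal_exp m k.+1 =i ideal_mul I (ideal_exp m k).
  move=> v; apply/idP/idP; last exact: ideal_mul_mono.
  by rewrite redK; exact: ideal_mul_mono.
have hM := reduction_scale k redI.
have : x ^+ k.+1 \in ideal_exp m k.+1 by apply: exprn_ideal_exp; exact: Im.
rewrite redK => /mem_ideal_mulP [p [kap [mu [kapK mum hx]]]].
pose M := ideal_exp m k.+1; pose P := ideal_mul m M.
have mP l (u y : R) : u \in ideal_exp m l -> y \in P -> exists2 y' : R, y' \in P & u * y = x ^+ l * y'.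
  elim: l u y => [|l IHl] u y um yP.
    by exists (u * y); [exact: idealM | rewrite mul1r].
  have h : {subset ideal_exp m l.+1 <= colon (scale_submod (x ^+ l.+1) P) y}.
    apply: ideal_mul_sub => a b am bm; apply/mem_colon/mem_scale.
    have [y' yP' hy'] := IHl b y bm yP.
    have : y' * a \in scale_submod x P.
      apply/mem_colon; move: y' yP' {hy'}; apply: ideal_mul_sub => b' v bm' vM.
      apply/mem_colon/mem_scale; have [w wM hw] := hM a v am vM.
      exists (b' * w); first exact: mem_ideal_mul.
      rewrite (_ : _ * a = b' * (a * v)); last ring.
      by rewrite hw mulrCA.
    move=> /mem_scale [w wP hw]; exists w => //.
    by rewrite -mulrA hy' mulrCA [a * y']mulrC hw exprSr mulrA.
  by have /mem_colon/mem_scale [y' ? ?] := h _ um; exists y'.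
apply: (general_element hN hloc hinf regx hM (fun y yK => Im _ (KI y yK))
  [seq kap j | j <- enum 'I_p]).
  by move=> y /mapP [j _ ->].
move=> v vM hv.
have /choice [q hq] : forall j, exists q, q \in P /\ kap j * v = x * q.
  move=> j; have [|q ? ?] := hv (kap j); last by exists q.
  by apply: map_f; rewrite mem_enum.
have /choice [q' hq'] : forall j, exists q', q' \in P /\ mu j * q j = x ^+ k * q'.
  by move=> j; have [q' ? ?] := mP k _ _ (mum j) (hq j).1; exists q'.
have -> : v = \sum_(j < p) q' j.
  apply: (lregX (n := k.+1) regx); rewrite {1}hx mulr_suml mulr_sumr.
  apply: eq_bigr => j _; rewrite [kap j * _]mulrC -mulrA (hq j).2 mulrCA (hq' j).2.
  by rewrite exprS mulrA.
by apply: ideal_sum => j _; exact: (hq' j).1.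
Qed.

End Reductions.

(* K' = (x / a) K, the canonical ideal isomorphic to K in which x plays the role of a. *)
Lemma canonical_ideal_scale {R : comNzRingType} {m K : ideal R} (x a : R) :
  GRing.lreg x -> GRing.lreg a -> a \in K -> canonical_ideal m K ->
  (forall k : R, k \in K -> exists r, x * k = a * r) ->
  exists2 K' : ideal R, canonical_ideal m K' & x \in K'.
Proof.
move=> regx rega aK [W canW [f bijf]] hK.
have h0 : exists2 k : R, k \in K & a * 0 = x * k.
  by exists 0; rewrite ?ideal0 ?mulr0.
have hP (c u v : R) : (exists2 k : R, k \in K & a * u = x * k) ->
    (exists2 k : R, k \in K & a * v = x * k) ->
    exists2 k : R, k \in K & a * (c * u + v) = x * k.
  move=> [k kK hk] [l lK hl]; exists (c * k + l).
    by apply: idealD => //; exact: idealM.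
  by rewrite !mulrDr hl !(mulrCA _ c) hk.
pose K' : ideal R := @mk_submod R R^o (fun v : R => exists2 k : R, k \in K & a * v = x * k) h0 hP.
have memK' (v : R) : v \in K' <-> exists2 k : R, k \in K & a * v = x * k.
  exact: mem_mk_ideal.
exists K'; last by apply/memK'; exists a; rewrite // mulrC.
exists W => //.
have /choice [g hg] : forall u : submod_type K', exists k : submod_type K,
    a * (val u : R) = x * (val k : R).
  by move=> u; have /memK' [k kK hk] := valP u; exists (SubmodElt kK).
have /choice [g' hg'] : forall k : submod_type K, exists u : submod_type K',
    a * (val u : R) = x * (val k : R).
  move=> k; have [r hr] := hK _ (valP k).
  have rK : r \in K' by apply/memK'; exists (val k); [exact: valP | rewrite hr].
  by exists (SubmodElt rK); rewrite hr.
have [|G hG] := @linear_intro R (submod_type K') (submod_type K) g.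
  move=> c u v; apply/val_inj/regx.
  rewrite -hg -[val _]/(c * (val u : R) + (val v : R)).
  rewrite -[val (_ + _)]/(c * (val (g u) : R) + (val (g v) : R)).
  by rewrite !mulrDr hg !(mulrCA _ c) hg.
have bijG : bijective G.
  exists g' => [u|k]; apply/val_inj.
    by apply: rega; rewrite hg' hG hg.
  by apply: regx; rewrite hG -hg hg'.
have [|F hF] := @linear_intro R (submod_type K') W (f \o G).
  by move=> c u v /=; rewrite !linearP.
by exists F; apply: eq_bij (bij_comp bijf bijG) _ _.
Qed.

Theorem mainTheorem4 (R : comNzRingType) (m : ideal R)
  (hnoeth : noetherian R) (hlocal : local_ring m)
  (hdim : krull_dim R 1%N) (hCM : cohen_macaulay m)
  (hinf : infinite_set [set: quotmod m])
  (hcan : exists K : ideal R, canonical_ideal m K)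
  (I : ideal R) (hI : ulrich_ideal m I)
  (hmu : exists2 n : nat, min_gens (submod_type I) n & (2 < n)%N) :
  (exists K : ideal R, canonical_reduction m K)
  <-> (generalized_gorenstein m I /\ reduction I m).
Proof.
case: hI => Im [x [xI regx /(ideal_exp2_scale x I xI) sqI]] freeI.
have Isub : {subset I <= m} := primary_sub_max Im.
(* Stated for any [c], since a general element of [K] will take the place of [x]. *)
have basis c : GRing.lreg c -> c \in I -> square_eq c I ->
    exists n (i0 : 'I_n) (X : 'I_n -> R), ulrich_basis I c i0 X /\ (2 < n)%N.
  move=> regc cI sqc.
  have [n [i0 [X [bX hn]]]] := exists_ulrich_basis hnoeth hlocal regc cI sqc Im freeI.
  exists n, i0, X; split=> //; have [k mink k2] := hmu.
  exact: leq_trans k2 (hn k mink).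
have [n [i0 [X [basX n2]]]] := basis x regx xI sqI.
have canI K j : canonical_ideal m K -> x ^+ j \in K -> {subset K <= I}.
  move=> canK xK.
  exact: (canonical_sub_ulrich hnoeth hlocal regx xI sqI Im hdim basX canK j xK n2).
split=> [[K [canK [Km [k redK]]]]|[[K [C [f [g [canK [injf exf surjg] annC _]]]]] [_ [k redI]]]].
  have xK : x ^+ k.+1 \in K.
    have : x ^+ k.+1 \in ideal_exp m k.+1 by apply: exprn_ideal_exp; exact: Isub.
    rewrite redK; move: (x ^+ k.+1); apply: ideal_mul_sub => a b aK _.
    exact: idealMr.
  have KI := canI K _ canK xK.
  have [c cK hc] := reduction_element hnoeth hlocal hinf regx xI sqI Isub k KI redK.
  have cI := KI _ cK.
  have xm : x ^+ k.+1 \in ideal_exp m k.+1 by apply: exprn_ideal_exp; exact: Isub.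
  have [regc sqc] := square_eq_change regx sqI
    (square_mem_scale hnoeth regx xI cI sqI _ xm hc).
  have [n' [i0' [X' [basX' n2']]]] := basis c regc cI sqc.
  split; first exact: (generalized_gorenstein_ulrich hnoeth hlocal hdim regc cI sqc Im basX' n2' canK cK).
  split=> //; exists k => v; apply/idP/idP.
    by rewrite redK; exact: ideal_mul_mono.
  exact: ideal_mul_mono.
pose a : R := val (f (1 : R)).
have fE (r : R) : (val (f r) : R) = a * r.
  have -> : f r = r *: f (1 : R) by rewrite -linearZ; congr (f _); exact/esym/mulr1.
  by rewrite ideal_valZ mulrC.
have rega : GRing.lreg a.
  by move=> r r' h; apply: injf; apply/val_inj; rewrite [LHS]fE [RHS]fE.
have [|K' canK' xK'] := canonical_ideal_scale x a regx rega (valP (f (1 : R))) canK.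
  (* As [x] lies in [I], it kills C, so xK lies in aR. *)
  move=> y yK; have /exf [r hr] : g (x *: SubmodElt yK) = 0.
    by rewrite linearZ; exact: (annC x).1.
  by exists r; rewrite -fE hr.
have KI' : {subset K' <= I} by apply: (canI _ 1%N) => //; rewrite expr1.
exists K'; split=> //; split; first by move=> y /KI'/Isub.
(* The exponent grows by one because [reduction_scale] gives m^(k+2) inside x m^(k+1), and [x] is in
   [K']. *)
exists k.+1 => v; apply/idP/idP; last first.
  by apply: ideal_mul_mono => y /KI'/Isub.
move: v; apply: ideal_mul_sub => b v bm vM.
have [w wM ->] := reduction_scale sqI Isub k redI b v bm vM.
exact: mem_ideal_mul.
Qed.
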